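(* Let $\mathbb{G}$ be a (general) compact quantum group, $\mathcal{A}=\mathrm{Pol}(\mathbb{G})$ and $\mathcal{A}^{\mathrm{cop}}=\mathrm{Pol}(\mathbb{G}^{\mathrm{cop}})$. The algebra $\widetilde{\Delta}(\mathcal{A})$ is expected (i.e. there exists a positive unital projection $E:\mathcal{A}\odot\mathcal{A}^{\mathrm{cop}}\to\widetilde{\Delta}(\mathcal{A})$ preserving the Haar state of $\mathcal{A}\odot\mathcal{A}^{\mathrm{cop}}$) if and only if $\mathbb{G}$ is of Kac type.
   Context: $\mathrm{Pol}(\mathbb{G})$ is the Hopf $*$-algebra of the compact quantum group $\mathbb{G}$, with coproduct $\Delta$ and Haar state $h$. $\mathbb{G}$ is of Kac type if $h$ is a trace. $\mathbb{G}^{\mathrm{cop}}$ is the compact quantum group obtained from $\mathbb{G}$ by keeping the $*$-algebra and replacing $\Delta$ by $\Sigma\circ\Delta$, $\Sigma$ being the tensor flip; $\widetilde{\ }:\mathcal{A}\to\mathcal{A}^{\mathrm{cop}}$ denotes the formal identity map. The algebraic tensor product $\mathcal{A}\odot\mathcal{A}^{\mathrm{cop}}=\mathrm{Pol}(\mathbb{G}\times\mathbb{G}^{\mathrm{cop}})$ has the coproduct $\Delta^{\iota,\mathrm{cop}}(a\otimes\widetilde b)=a_{(1)}\otimes\widetilde{b_{(2)}}\otimes a_{(2)}\otimes\widetilde{b_{(1)}}$ (Sweedler notation), and its Haar state is $a\otimes\widetilde b\mapsto h(a)h(b)$. The map $\widetilde\Delta=(\mathrm{id}_{\mathcal{A}}\otimes\widetilde{\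 })\circ\Delta:\mathcal{A}\to\mathcal{A}\odot\mathcal{A}^{\mathrm{cop}}$ is an injective unital $*$-homomorphism. ''Projection onto'' means an idempotent linear map with the given image. *)

(* Defs.v *)
From HB Require Import structures.
From mathcomp Require Import all_boot all_order all_algebra.
From mathcomp Require Import generic_quotient complex.
From mathcomp Require Import boolp classical_sets reals.

Set Implicit Arguments.
Unset Strict Implicit.
Unset Printing Implicit Defensive.

Import Order.TTheory GRing.Theory Num.Theory.
Local Open Scope ring_scope.
Local Open Scope quotient_scope.

Reserved Notation "U ⊙ V" (at level 40, left associativity).
Reserved Notation "u ⊗ v" (at level 40, left associativity).

Notation is_bilinear f := (bilinear_for *:%R *:%R f).

(* A finite sequence of pairs stands for the formal sum of its elementary
   tensors; two formal sums are identified when every bilinear map, into any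
   vector space, takes the same value on them.                               *)
Section Tensor.
Context {K : fieldType}.
Variables U V : lmodType K.
Implicit Types (s t : seq (U * V)).

Definition bisum (W : nmodType) (f : U -> V -> W) s : W :=
  \sum_(p <- s) f p.1 p.2.

Definition tensor_rel s t : bool :=
  `[< forall (W : lmodType K) (f : U -> V -> W),
        is_bilinear f -> bisum f s = bisum f t >].

Lemma tensor_rel_refl : reflexive tensor_rel.
Proof. by move=> s; apply/asboolP. Qed.

Lemma tensor_rel_sym : symmetric tensor_rel.
Proof.
by move=> s t; apply/asboolP/asboolP => h W f bf; rewrite (h W f).
Qed.

Lemma tensor_rel_trans : transitive tensor_rel.
Proof.
move=> t s r /asboolP hs /asboolP hr; apply/asboolP => W f bf.
by rewrite (hs W f bf) (hr W f bf).
Qed.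

Canonical tensor_equiv :=
  EquivRel tensor_rel tensor_rel_refl tensor_rel_sym tensor_rel_trans.

Definition tensor := {eq_quot tensor_equiv}.
HB.instance Definition _ := Choice.on tensor.
HB.instance Definition _ := EqQuotient.on tensor.

Lemma tensor_eqP s t :
  (forall (W : lmodType K) (f : U -> V -> W),
     is_bilinear f -> bisum f s = bisum f t) <->
  \pi_tensor s = \pi_tensor t.
Proof.
split=> [h|/eqmodP/asboolP //]; apply/eqmodP/asboolP; exact: h.
Qed.

Lemma bisum_repr (W : lmodType K) (f : U -> V -> W) s :
  is_bilinear f -> bisum f (repr (\pi_tensor s)) = bisum f s.
Proof. by move=> bf; apply: (proj2 (tensor_eqP _ _)); rewrite ?reprK. Qed.

Lemma bisum_cat (W : nmodType) (f : U -> V -> W) s t :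
  bisum f (s ++ t) = bisum f s + bisum f t.
Proof. by rewrite /bisum big_cat. Qed.

Definition scale_seq (k : K) s := [seq (k *: p.1, p.2) | p <- s].

Lemma bisum_scale (W : lmodType K) (f : U -> V -> W) k s :
  is_bilinear f -> bisum f (scale_seq k s) = k *: bisum f s.
Proof.
move=> [fl _]; rewrite /bisum big_map scaler_sumr; apply: eq_bigr => p _ /=.
by have := scalable_linear (fl p.2) k p.1.
Qed.

Definition tensor_zero : tensor := \pi_tensor [::].
Definition tensor_add (x y : tensor) : tensor := \pi_tensor (repr x ++ repr y).
Definition tensor_scale (k : K) (x : tensor) : tensor :=
  \pi_tensor (scale_seq k (repr x)).
Definition tensor_opp (x : tensor) : tensor := tensor_scale (-1) x.

Lemma tensor_ext (x y : tensor) :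
  (forall (W : lmodType K) (f : U -> V -> W),
     is_bilinear f -> bisum f (repr x) = bisum f (repr y)) -> x = y.
Proof. by move=> h; rewrite -[x]reprK -[y]reprK; apply/tensor_eqP. Qed.

Lemma bisum_add (W : lmodType K) (f : U -> V -> W) x y : is_bilinear f ->
  bisum f (repr (tensor_add x y)) = bisum f (repr x) + bisum f (repr y).
Proof. by move=> bf; rewrite bisum_repr // bisum_cat. Qed.

Lemma bisum_tscale (W : lmodType K) (f : U -> V -> W) k x : is_bilinear f ->
  bisum f (repr (tensor_scale k x)) = k *: bisum f (repr x).
Proof. by move=> bf; rewrite bisum_repr // bisum_scale. Qed.

Lemma bisum_zero (W : lmodType K) (f : U -> V -> W) : is_bilinear f ->
  bisum f (repr tensor_zero) = 0.
Proof. by move=> bf; rewrite bisum_repr // /bisum big_nil. Qed.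

Let bisumE := (bisum_add, bisum_tscale, bisum_zero).

Lemma tensor_addA : associative tensor_add.
Proof. by move=> x y z; apply: tensor_ext => W f bf; rewrite !bisumE // addrA. Qed.
Lemma tensor_addC : commutative tensor_add.
Proof. by move=> x y; apply: tensor_ext => W f bf; rewrite !bisumE // addrC. Qed.
Lemma tensor_add0 : left_id tensor_zero tensor_add.
Proof. by move=> x; apply: tensor_ext => W f bf; rewrite !bisumE // add0r. Qed.
Lemma tensor_addN : left_inverse tensor_zero tensor_opp tensor_add.
Proof.
by move=> x; apply: tensor_ext => W f bf; rewrite !bisumE // scaleN1r addNr.
Qed.

HB.instance Definition _ :=
  GRing.isZmodule.Build tensor tensor_addA tensor_addC tensor_add0 tensor_addN.

Lemma tensor_scaleA a b x :
  tensor_scale a (tensor_scale b x) = tensor_scale (a * b) x.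
Proof. by apply: tensor_ext => W f bf; rewrite !bisumE // scalerA. Qed.
Lemma tensor_scale1 : left_id 1 tensor_scale.
Proof. by move=> x; apply: tensor_ext => W f bf; rewrite !bisumE // scale1r. Qed.
Lemma tensor_scaleDr : right_distributive tensor_scale +%R.
Proof.
by move=> a x y; apply: tensor_ext => W f bf; rewrite !bisumE // scalerDr.
Qed.
Lemma tensor_scaleDl x : {morph tensor_scale^~ x : a b / a + b}.
Proof.
by move=> a b; apply: tensor_ext => W f bf; rewrite !bisumE // scalerDl.
Qed.

HB.instance Definition _ := GRing.Zmodule_isLmodule.Build K tensor
  tensor_scaleA tensor_scale1 tensor_scaleDr tensor_scaleDl.

Definition pure (u : U) (v : V) : tensor := \pi_tensor [:: (u, v)].

(* The linear extension of a map given on elementary tensors. It is defined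
   for every f, through a chosen representative, but is independent of that
   choice only when f is bilinear.                                           *)
Definition tlift (W : nmodType) (f : U -> V -> W) (x : tensor) : W :=
  bisum f (repr x).

Lemma tliftE (W : lmodType K) (f : U -> V -> W) u v :
  is_bilinear f -> tlift f (pure u v) = f u v.
Proof. by move=> bf; rewrite /tlift bisum_repr // /bisum big_seq1. Qed.

Lemma tlift_linear (W : lmodType K) (f : U -> V -> W) :
  is_bilinear f -> linear (tlift f).
Proof. by move=> bf k x y; rewrite /tlift bisum_add // bisum_tscale. Qed.

Lemma pure_bilinear : is_bilinear pure.
Proof.
split=> [v k u u'|u k v v']; apply: tensor_ext => W f bf; have [fl fr] := bf;
  rewrite bisum_add // bisum_tscale // !bisum_repr // /bisum !big_seq1 /=.
- exact: fl.
- exact: fr.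
Qed.

Lemma piE s : \pi_tensor s = \sum_(p <- s) pure p.1 p.2.
Proof.
elim: s => [|p s IH]; first by rewrite big_nil.
rewrite big_cons -IH; apply: tensor_ext => W f bf.
rewrite bisum_add // !bisum_repr // /bisum big_cons big_seq1 //=.
Qed.

Lemma tensorE (x : tensor) : x = tlift pure x.
Proof. by rewrite -{1}[x]reprK piE. Qed.

Lemma eq_tlift (W : nmodType) (f g : U -> V -> W) :
  (forall u v, f u v = g u v) -> tlift f =1 tlift g.
Proof. by move=> h x; apply: eq_bigr => p _; apply: h. Qed.

Lemma tensor_linear_ext (W : lmodType K) (f g : tensor -> W) :
  linear f -> linear g -> (forall u v, f (pure u v) = g (pure u v)) -> f =1 g.
Proof.
have sumE (h : tensor -> W) : linear h ->
    forall s, h (\pi_tensor s) = \sum_(p <- s) h (pure p.1 p.2).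
  move=> lh; pose hl := GRing.isLinear.Build _ _ _ _ h lh.
  pose h' : {linear tensor -> W} := HB.pack h hl.
  by move=> s; rewrite piE -[h]/(h' : _ -> _) raddf_sum.
move=> lf lg h x; rewrite -[x]reprK !sumE //.
by apply: eq_bigr => p _; apply: h.
Qed.

End Tensor.

Notation "U ⊙ V" := (tensor U V) : type_scope.
Notation "u ⊗ v" := (pure u v) : ring_scope.

Section Functional.
Context {K : fieldType}.
Variables (V : lmodType K) (v : V).
Hypothesis v_neq0 : v != 0.
Local Open Scope classical_set_scope.

Let subspace_avoiding (M : set V) :=
  [/\ M `&` [set v] = set0, forall k x y, M x -> M y -> M (k *: x + y)
    & (M !=set0 -> M 0)].

Lemma exists_functional : exists f : V -> K, scalar f /\ f v = 1.
Proof.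
have [|M [[Mv MD M0] Mmax]] := @Zorn_bigcup V subspace_avoiding.
  move=> F FP Ftot; split.
  - rewrite -subset0 => x [[X FX Xx] xv].
    by have [X0 _ _] := FP _ FX; rewrite -X0.
  - move=> k x y [X FX Xx] [Y FY Yy].
    have [_ XD _] := FP _ FX; have [_ YD _] := FP _ FY.
    have [XY|YX] := Ftot _ _ FX FY.
    + by exists Y => //; apply: YD => //; apply: XY.
    + by exists X => //; apply: XD => //; apply: YX.
  - move=> [x [X FX Xx]]; have [_ _ X0] := FP _ FX.
    by exists X => //; apply: X0; exists x.
have nMv : ~ M v by move=> h; rewrite -[False]/(set0 v) -Mv.
have {}M0 : M 0.
  apply: contrapT => nM0; apply: (Mmax [set 0]).
    split=> [x Mx|]; last by move/(_ 0 erefl).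
    by case: nM0; apply: M0; exists x.
  split=> //.
  - rewrite -subset0 => x [/= -> v0].
    by move: v_neq0; rewrite -v0 eqxx.
  - by move=> k x y /= -> ->; rewrite scaler0 addr0.
have MZ k x : M x -> M (k *: x) by move=> Mx; rewrite -[_ *: _]addr0; apply: MD.
have MA x y : M x -> M y -> M (x + y).
  by move=> Mx My; rewrite -[x]scale1r; apply: MD.
have ex a : exists k : K, M (a - k *: v).
  apply: contrapT => nex.
  have nMa : ~ M a by move=> Ma; apply: nex; exists 0; rewrite scale0r subr0.
  apply: (Mmax [set x | exists k, M (x - k *: a)]).
    split=> [x Mx|h]; first by exists 0; rewrite scale0r subr0.
    by apply: nMa; apply: h; exists 1; rewrite scale1r subrr.
  split.
  - rewrite -subset0 => x [[k Mk] /= xv]; move: Mk; rewrite {}xv => Mk.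
    have [k0|k0] := eqVneq k 0; first by apply: nMv; rewrite k0 scale0r subr0 in Mk.
    apply: nex; exists k^-1; have := MZ (- k^-1) _ Mk.
    by rewrite scalerBr !scaleNr scalerA mulVf // scale1r opprK addrC.
  - move=> k x y [i Mi] [j Mj]; exists (k * i + j).
    have := MD k _ _ Mi Mj.
    by rewrite scalerBr scalerDl opprD -scalerA addrACA.
  - by move=> _; exists 0; rewrite scale0r subr0.
have uniq a k l : M (a - k *: v) -> M (a - l *: v) -> k = l.
  move=> Mk Ml; apply: contrapT => /eqP kl; apply: nMv.
  have := MZ (l - k)^-1 _ (MD (-1) _ _ Ml Mk).
  rewrite scaleN1r opprB addrA subrK -scalerBl scalerA mulVf ?scale1r //.
  by rewrite subr_eq0 eq_sym.
pose f a := projT1 (cid (ex a)).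
have fP a : M (a - f a *: v) by rewrite /f; case: cid.
exists f; split=> [k x y|]; last first.
  by apply: (uniq v) => //; rewrite scale1r subrr.
apply: (uniq (k *: x + y)) => //=.
have := MD k _ _ (fP x) (fP y).
by rewrite scalerBr scalerDl opprD -scalerA addrACA.
Qed.

End Functional.

Section TensorAlgebra.
Context {K : fieldType}.
Variables A B : algType K.

Definition tensor_one : A ⊙ B := 1 ⊗ 1.
Definition tensor_mul (x y : A ⊙ B) : A ⊙ B :=
  tlift (fun a b => tlift (fun a' b' => (a * a') ⊗ (b * b')) y) x.

Lemma tensor_mul_bil a b :
  is_bilinear (fun a' b' => (a * a') ⊗ (b * b') : A ⊙ B).
Proof.
have [bl br] := @pure_bilinear K A B.
by split=> [b' k u u'|a' k u u'] /=; rewrite mulrDr -scalerAr; [apply: bl|apply: br].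
Qed.

Lemma tensor_mul_bil2 (y : A ⊙ B) :
  is_bilinear (fun a b => tlift (fun a' b' => (a * a') ⊗ (b * b')) y : A ⊙ B).
Proof.
have [bl br] := @pure_bilinear K A B.
split=> [b k u u'|a k u u'] /=; rewrite /tlift /bisum scaler_sumr -big_split /=;
  apply: eq_bigr => p _; rewrite mulrDl -scalerAl; [exact: bl|exact: br].
Qed.

Lemma tensor_mulE a b a' b' :
  tensor_mul (a ⊗ b) (a' ⊗ b') = (a * a') ⊗ (b * b').
Proof.
by rewrite /tensor_mul (tliftE _ _ (tensor_mul_bil2 _)) (tliftE _ _ (tensor_mul_bil _ _)).
Qed.

Lemma tensor_mul_linl y : linear (tensor_mul^~ y).
Proof. exact: tlift_linear (tensor_mul_bil2 y). Qed.

Lemma tensor_mul_linr x : linear (tensor_mul x).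
Proof.
move=> k y y'; rewrite /tensor_mul {1 3 5}/tlift /bisum scaler_sumr -big_split /=.
by apply: eq_bigr => p _; apply: (tlift_linear (tensor_mul_bil _ _)).
Qed.

Lemma linear_comp (U V W : lmodType K) (f : V -> W) (g : U -> V) :
  linear f -> linear g -> linear (fun x => f (g x)).
Proof. by move=> lf lg k x y; rewrite lg lf. Qed.

Lemma tensor_mulA : associative tensor_mul.
Proof.
move=> x y z; move: x; apply: tensor_linear_ext.
- exact: tensor_mul_linl.
- by apply: (linear_comp (f := tensor_mul^~ z)); apply: tensor_mul_linl.
move=> a b; move: y; apply: tensor_linear_ext.
- by apply: (linear_comp (g := tensor_mul^~ z)); [apply: tensor_mul_linr|apply: tensor_mul_linl].
- by apply: (linear_comp (f := tensor_mul^~ z)); [apply: tensor_mul_linl|apply: tensor_mul_linr].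
move=> a' b'; move: z; apply: tensor_linear_ext.
- by apply: (linear_comp (g := tensor_mul _)); apply: tensor_mul_linr.
- exact: tensor_mul_linr.
by move=> a'' b''; rewrite !tensor_mulE !mulrA.
Qed.

Lemma tensor_mul1 : left_id tensor_one tensor_mul.
Proof.
apply: tensor_linear_ext => [||a b]; first exact: tensor_mul_linr.
- by [].
- by rewrite tensor_mulE !mul1r.
Qed.

Lemma tensor_mulr1 : right_id tensor_one tensor_mul.
Proof.
apply: tensor_linear_ext => [||a b]; first exact: tensor_mul_linl.
- by [].
- by rewrite tensor_mulE !mulr1.
Qed.

Lemma tensor_mulDl : left_distributive tensor_mul +%R.
Proof. by move=> x y z; have := tensor_mul_linl z 1 x y; rewrite !scale1r. Qed.

Lemma tensor_mulDr : right_distributive tensor_mul +%R.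
Proof. by move=> z x y; have := tensor_mul_linr z 1 x y; rewrite !scale1r. Qed.

Lemma tensor_one_neq0 : tensor_one != 0.
Proof.
have [f [lf f1]] := exists_functional (oner_neq0 A).
have [g [lg g1]] := exists_functional (oner_neq0 B).
pose h (a : A) (b : B) : K^o := f a * g b.
have bh : is_bilinear h.
  split=> [b k u u'|a k u u'] /=; rewrite /h.
  - by rewrite lf mulrDl scalerAl.
  - by rewrite lg mulrDr scalerAr.
apply/eqP => /(congr1 (tlift h)).
rewrite (tliftE _ _ bh) /h f1 g1 mulr1.
rewrite [RHS]/tlift (bisum_zero bh) => e.
by apply: (elimN eqP (oner_neq0 K)); apply: e.
Qed.

HB.instance Definition _ := GRing.Zmodule_isNzRing.Build (A ⊙ B)
  tensor_mulA tensor_mul1 tensor_mulr1 tensor_mulDl tensor_mulDr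
  tensor_one_neq0.

Lemma tensor_scaleAl k (x y : A ⊙ B) : k *: (x * y) = (k *: x) * y.
Proof. exact: esym (scalable_linear (tensor_mul_linl y) k x). Qed.
Lemma tensor_scaleAr k (x y : A ⊙ B) : k *: (x * y) = x * (k *: y).
Proof. exact: esym (scalable_linear (tensor_mul_linr x) k y). Qed.

HB.instance Definition _ :=
  GRing.Lmodule_isLalgebra.Build K (A ⊙ B) tensor_scaleAl.
HB.instance Definition _ :=
  GRing.Lalgebra_isAlgebra.Build K (A ⊙ B) tensor_scaleAr.

Lemma pureM (a a' : A) (b b' : B) :
  (a ⊗ b) * (a' ⊗ b') = (a * a') ⊗ (b * b').
Proof. exact: tensor_mulE. Qed.

End TensorAlgebra.

HB.mixin Record isStarAlgebra (R : realType) A of GRing.Algebra R[i] A := {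
  star : A -> A;
  starK : involutive star;
  starD : {morph star : a b / a + b};
  starZ : forall (k : R[i]) a, star (k *: a) = k^* *: star a;
  starM : forall a b, star (a * b) = star b * star a
}.
#[short(type="starAlgType")]
HB.structure Definition StarAlgebra (R : realType) :=
  {A of GRing.Algebra R[i] A & isStarAlgebra R A}.

Section StarTheory.
Variables (R : realType) (A : starAlgType R).

Lemma star1 : star (1 : A) = 1.
Proof. by rewrite -[LHS]mulr1 -{2}[1]starK -starM mulr1 starK. Qed.

Lemma star_sum (I : Type) (r : seq I) (P : pred I) (F : I -> A) :
  star (\sum_(i <- r | P i) F i) = \sum_(i <- r | P i) star (F i).
Proof.
apply: (big_morph _ (@starD R A)).
by apply: (addIr (star 0)); rewrite -starD !add0r.
Qed.

End StarTheory.

(* W with scalars acting through complex conjugation, so that conjugate-linear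
   maps into W are linear maps into conj_mod W.                              *)
Definition conj_mod (R : realType) (W : lmodType R[i]) : Type := W.

Section ConjMod.
Variables (R : realType) (W : lmodType R[i]).
HB.instance Definition _ := GRing.Zmodule.on (conj_mod W).

Definition conj_scale (k : R[i]) (w : conj_mod W) : conj_mod W :=
  k^* *: (w : W).

Lemma conj_scaleA a b w : conj_scale a (conj_scale b w) = conj_scale (a * b) w.
Proof. by rewrite /conj_scale scalerA rmorphM. Qed.
Lemma conj_scale1 : left_id 1 conj_scale.
Proof. by move=> w; rewrite /conj_scale rmorph1 scale1r. Qed.
Lemma conj_scaleDr : right_distributive conj_scale +%R.
Proof. by move=> a x y; rewrite /conj_scale scalerDr. Qed.
Lemma conj_scaleDl w : {morph conj_scale^~ w : a b / a + b}.
Proof. by move=> a b; rewrite /conj_scale rmorphD scalerDl. Qed.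

HB.instance Definition _ := GRing.Zmodule_isLmodule.Build R[i] (conj_mod W)
  conj_scaleA conj_scale1 conj_scaleDr conj_scaleDl.
End ConjMod.

Section TensorStar.
Variables (R : realType) (A B : starAlgType R).

Definition tensor_star (x : A ⊙ B) : A ⊙ B :=
  tlift (fun a b => star a ⊗ star b) x.

Let cpure (a : A) (b : B) : conj_mod (A ⊙ B) := star a ⊗ star b.

Lemma cpure_bilinear : is_bilinear cpure.
Proof.
have [bl br] := @pure_bilinear R[i] A B.
split=> [b k u u'|a k u u'] /=; rewrite /cpure starD starZ; [exact: bl|exact: br].
Qed.

Lemma tensor_starE a b : tensor_star (a ⊗ b) = star a ⊗ star b.
Proof. exact: (tliftE _ _ cpure_bilinear). Qed.

Lemma tensor_starP k x y :
  tensor_star (k *: x + y) = k^* *: tensor_star x + tensor_star y.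
Proof. exact: (tlift_linear cpure_bilinear). Qed.

Lemma tensor_starD : {morph tensor_star : x y / x + y}.
Proof. by move=> x y; have := tensor_starP 1 x y; rewrite rmorph1 !scale1r. Qed.

Lemma tensor_star0 : tensor_star 0 = 0.
Proof. by apply: (addIr (tensor_star 0)); rewrite -tensor_starD !add0r. Qed.

Lemma tensor_starZ k x : tensor_star (k *: x) = k^* *: tensor_star x.
Proof. by have := tensor_starP k x 0; rewrite tensor_star0 !addr0. Qed.

Lemma tensor_starK : involutive tensor_star.
Proof.
apply: (tensor_linear_ext (g := idfun)) => // [k x y|a b].
  by rewrite !tensor_starP conjCK.
by rewrite !tensor_starE !starK.
Qed.

Lemma tensor_starM (x y : A ⊙ B) :
  tensor_star (x * y) = tensor_star y * tensor_star x.
Proof.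
pose f (x : A ⊙ B) : conj_mod (A ⊙ B) := tensor_star (x * y).
pose g (x : A ⊙ B) : conj_mod (A ⊙ B) := tensor_star y * tensor_star x.
rewrite -[LHS]/(f x) -[RHS]/(g x); move: x; apply: (tensor_linear_ext (W := conj_mod (A ⊙ B))).
- by move=> k u v; rewrite /f mulrDl -scalerAl [LHS]tensor_starP.
- by move=> k u v; rewrite /g [in LHS]tensor_starP mulrDr -scalerAr.
move=> a b; rewrite {}/f {}/g.
pose f (y : A ⊙ B) : conj_mod (A ⊙ B) := tensor_star ((a ⊗ b) * y).
pose g (y : A ⊙ B) : conj_mod (A ⊙ B) := tensor_star y * tensor_star (a ⊗ b).
rewrite -[LHS]/(f y) -[RHS]/(g y); move: y; apply: (tensor_linear_ext (W := conj_mod (A ⊙ B))).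
- by move=> k u v; rewrite /f mulrDr -scalerAr [LHS]tensor_starP.
- by move=> k u v; rewrite /g [in LHS]tensor_starP mulrDl -scalerAl.
by move=> a' b'; rewrite /f /g pureM !tensor_starE pureM !starM.
Qed.

HB.instance Definition _ := isStarAlgebra.Build R (A ⊙ B)
  tensor_starK tensor_starD tensor_starZ tensor_starM.

End TensorStar.

Section TensorMaps.
Context {K : fieldType}.

Definition tmap (U V U' V' : lmodType K) (f : U -> U') (g : V -> V') :
    U ⊙ V -> U' ⊙ V' :=
  tlift (fun u v => f u ⊗ g v).

Definition tflip (U V : lmodType K) : U ⊙ V -> V ⊙ U :=
  tlift (fun u v => v ⊗ u).

Definition tassoc (U V W : lmodType K) : (U ⊙ V) ⊙ W -> U ⊙ (V ⊙ W) :=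
  tlift (fun x w => tlift (fun u v => u ⊗ (v ⊗ w)) x).

Lemma tmap_bilinear (U V U' V' : lmodType K)
    (f : {linear U -> U'}) (g : {linear V -> V'}) :
  is_bilinear (fun u v => f u ⊗ g v).
Proof.
have [bl br] := @pure_bilinear K U' V'.
by split=> [v k u u'|u k v v'] /=; rewrite linearP; [exact: bl|exact: br].
Qed.

HB.instance Definition _ (U V U' V' : lmodType K)
    (f : {linear U -> U'}) (g : {linear V -> V'}) :=
  GRing.isLinear.Build K (U ⊙ V) (U' ⊙ V') _ (tmap f g)
    (tlift_linear (tmap_bilinear f g)).

Lemma tmapE (U V U' V' : lmodType K)
    (f : {linear U -> U'}) (g : {linear V -> V'}) u v :
  tmap f g (u ⊗ v) = f u ⊗ g v.
Proof. exact: (tliftE _ _ (tmap_bilinear f g)). Qed.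

Lemma tflip_bilinear (U V : lmodType K) :
  is_bilinear (fun (u : U) (v : V) => v ⊗ u).
Proof. by have [bl br] := @pure_bilinear K V U; split. Qed.

HB.instance Definition _ (U V : lmodType K) :=
  GRing.isLinear.Build K (U ⊙ V) (V ⊙ U) _ (@tflip U V)
    (tlift_linear (tflip_bilinear U V)).

Lemma tflipE (U V : lmodType K) (u : U) (v : V) : tflip (u ⊗ v) = v ⊗ u.
Proof. exact: (tliftE _ _ (tflip_bilinear U V)). Qed.

Lemma tassoc_bilinear1 (U V W : lmodType K) (w : W) :
  is_bilinear (fun (u : U) (v : V) => u ⊗ (v ⊗ w)).
Proof.
have [bl br] := @pure_bilinear K U (V ⊙ W).
have [bl' br'] := @pure_bilinear K V W.
split=> [v k u u'|u k v v'] /=; first exact: bl.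
by rewrite -br -bl'.
Qed.

Lemma tassoc_bilinear2 (U V W : lmodType K) :
  is_bilinear (fun (x : U ⊙ V) (w : W) => tlift (fun u v => u ⊗ (v ⊗ w)) x).
Proof.
have [bl br] := @pure_bilinear K U (V ⊙ W).
have [bl' br'] := @pure_bilinear K V W.
split=> [w|x k w w']; first exact: (tlift_linear (tassoc_bilinear1 _ _ _)).
rewrite /= /tlift /bisum scaler_sumr -big_split /=.
by apply: eq_bigr => p _; rewrite -br -br'.
Qed.

HB.instance Definition _ (U V W : lmodType K) :=
  GRing.isLinear.Build K ((U ⊙ V) ⊙ W) (U ⊙ (V ⊙ W)) _ (@tassoc U V W)
    (tlift_linear (tassoc_bilinear2 U V W)).

Lemma tassocE (U V W : lmodType K) (u : U) (v : V) (w : W) :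
  tassoc ((u ⊗ v) ⊗ w) = u ⊗ (v ⊗ w).
Proof.
rewrite /tassoc (tliftE _ _ (tassoc_bilinear2 _ _ _)).
exact: (tliftE _ _ (tassoc_bilinear1 _ _ _)).
Qed.

Lemma tlift_flip (U V W : lmodType K) (f : U -> V -> W) x :
  is_bilinear f -> tlift f (tflip x) = tlift (fun v u => f u v) x.
Proof.
move=> bf; have bf' : is_bilinear (fun v u => f u v) by have [] := bf; split.
move: x; apply: tensor_linear_ext.
- by move=> k x y; rewrite linearP; apply: (tlift_linear bf).
- exact: (tlift_linear bf').
by move=> v u; rewrite tflipE !tliftE.
Qed.

End TensorMaps.

HB.mixin Record isHopfStarAlgebra (R : realType) A of StarAlgebra R A := {
  comul : {linear A -> A ⊙ A};
  counit : {scalar A};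
  antipode : {linear A -> A};
  comul1 : comul 1 = 1;
  comulM : {morph comul : a b / a * b};
  comul_star : {morph comul : a / star a};
  comulA : forall a,
    tassoc (tmap comul idfun (comul a)) = tmap idfun comul (comul a);
  counit1 : counit 1 = 1;
  counitM : {morph counit : a b / a * b};
  counitl : forall a, tlift (fun b c => counit b *: c) (comul a) = a;
  counitr : forall a, tlift (fun b c => counit c *: b) (comul a) = a;
  antipodel : forall a,
    tlift (fun b c => antipode b * c) (comul a) = (counit a)%:A;
  antipoder : forall a,
    tlift (fun b c => b * antipode c) (comul a) = (counit a)%:A
}.
#[short(type="hopfStarAlgType")]
HB.structure Definition HopfStarAlgebra (R : realType) :=
  {A of StarAlgebra R A & isHopfStarAlgebra R A}.

Definition unitary_corep (R : realType) (A : hopfStarAlgType R) (n : nat)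
    (u : 'M[A]_n) : Prop :=
  [/\ forall i j, comul (u i j) = \sum_k u i k ⊗ u k j,
      u *m (map_mx star u)^T = 1%:M
    & (map_mx star u)^T *m u = 1%:M].

Definition matrix_coef (R : realType) (A : hopfStarAlgType R) (a : A) : Prop :=
  exists (n : nat) (u : 'M[A]_n) (i j : 'I_n), unitary_corep u /\ a = u i j.

(* Pol(G) for a compact quantum group G: a Hopf *-algebra spanned by the matrix
   coefficients of its finite-dimensional unitary corepresentations, with its
   Haar state. The state is determined by haar1 and either invariance; its
   positivity and faithfulness on Pol(G) are then automatic.                 *)
HB.mixin Record isCompactQuantumGroup (R : realType) A
    of HopfStarAlgebra R A := {
  coef_span : forall a : A, exists s : seq (R[i] * A),
    (forall p, p \in s -> matrix_coef p.2) /\ a = \sum_(p <- s) p.1 *: p.2;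
  haar : {scalar A};
  haar1 : haar 1 = 1;
  haar_ge0 : forall a, 0 <= haar (star a * a);
  haar_faithful : forall a, haar (star a * a) = 0 -> a = 0;
  haar_invl : forall a, tlift (fun b c => haar b *: c) (comul a) = (haar a)%:A;
  haar_invr : forall a, tlift (fun b c => haar c *: b) (comul a) = (haar a)%:A
}.
#[short(type="cqgType")]
HB.structure Definition CompactQuantumGroup (R : realType) :=
  {A of HopfStarAlgebra R A & isCompactQuantumGroup R A}.

Definition kac_type (R : realType) (A : cqgType R) : Prop :=
  forall a b : A, haar (a * b) = haar (b * a).

(* A^cop carries the *-algebra structure and the Haar state of A, and the
   flipped coproduct.                                                        *)
Definition cop (A : Type) : Type := A.

Section Cop.
Variable R : realType.

HB.instance Definition _ (A : starAlgType R) := StarAlgebra.on (cop A).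

Section CopHopf.
Variable A : hopfStarAlgType R.

Definition cop_comul (a : cop A) : cop A ⊙ cop A := tflip (comul (a : A)).
Definition cop_counit (a : cop A) : R[i] := counit (a : A).

(* The inverse of the antipode of A. *)
Definition cop_antipode (a : cop A) : cop A := star (antipode (star (a : A))).

Lemma cop_comul_linear : linear cop_comul.
Proof. by move=> k a b; rewrite /cop_comul !linearP. Qed.
HB.instance Definition _ :=
  GRing.isLinear.Build R[i] (cop A) (cop A ⊙ cop A) _ cop_comul cop_comul_linear.

Lemma cop_counit_linear : scalar cop_counit.
Proof. by move=> k a b; rewrite /cop_counit linearP. Qed.
HB.instance Definition _ :=
  GRing.isLinear.Build R[i] (cop A) R[i] _ cop_counit cop_counit_linear.

Lemma cop_antipode_linear : linear cop_antipode.
Proof.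
move=> k a b.
by rewrite /cop_antipode starD starZ linearP starD starZ conjCK.
Qed.
HB.instance Definition _ :=
  GRing.isLinear.Build R[i] (cop A) (cop A) _ cop_antipode cop_antipode_linear.

Lemma tflip1 : tflip (1 : A ⊙ A) = 1.
Proof. exact: tflipE. Qed.

Lemma tflipM (x y : A ⊙ A) : tflip (x * y) = tflip x * tflip y.
Proof.
move: x; apply: tensor_linear_ext.
- by move=> k u v; rewrite mulrDl -scalerAl linearP.
- by move=> k u v; rewrite linearP mulrDl -scalerAl.
move=> a b; move: y; apply: tensor_linear_ext.
- by move=> k u v; rewrite mulrDr -scalerAr linearP.
- by move=> k u v; rewrite linearP mulrDr -scalerAr.
by move=> a' b'; rewrite pureM !tflipE pureM.
Qed.

Lemma star_pure (a b : A) : star (a ⊗ b) = star a ⊗ star b.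
Proof. exact: tensor_starE. Qed.

Lemma tflip_star (x : A ⊙ A) : tflip (star x) = star (tflip x).
Proof.
pose f (x : A ⊙ A) : conj_mod (A ⊙ A) := tflip (star x).
pose g (x : A ⊙ A) : conj_mod (A ⊙ A) := star (tflip x).
rewrite -[LHS]/(f x) -[RHS]/(g x); move: x.
apply: (tensor_linear_ext (W := conj_mod (A ⊙ A))).
- by move=> k u v; rewrite /f starD starZ linearP.
- by move=> k u v; rewrite /g linearP starD starZ.
by move=> a b; rewrite /f /g star_pure !tflipE star_pure.
Qed.

Lemma cop_comul1 : cop_comul 1 = 1.
Proof. by rewrite /cop_comul comul1 tflip1. Qed.

Lemma cop_comulM : {morph cop_comul : a b / a * b}.
Proof. by move=> a b; rewrite /cop_comul comulM tflipM. Qed.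

Lemma cop_comul_star : {morph cop_comul : a / star a}.
Proof. by move=> a; rewrite /cop_comul comul_star tflip_star. Qed.

Lemma cop_comulA a :
  tassoc (tmap cop_comul idfun (cop_comul a)) =
  tmap idfun cop_comul (cop_comul a).
Proof.
pose rev (x : A ⊙ (A ⊙ A)) := tassoc (tmap (@tflip _ A A) idfun (tflip x)).
have -> : tassoc (tmap cop_comul idfun (cop_comul a)) =
          rev (tmap idfun comul (comul a)).
  rewrite -[cop_comul a]/(tflip (comul (a : A))); move: (comul _); apply: tensor_linear_ext => [k x y|k x y|b c].
  - by do !rewrite linearP /=.
  - by rewrite /rev; do !rewrite linearP /=.
  - by rewrite /rev tmapE !tflipE !tmapE.
rewrite -comulA -[cop_comul a]/(tflip (comul (a : A))).
move: (comul _); apply: tensor_linear_ext => [k x y|k x y|b c].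
- by rewrite /rev; do !rewrite linearP /=.
- by do !rewrite linearP /=.
rewrite tflipE !tmapE /= /cop_comul.
move: (comul b); apply: tensor_linear_ext => [k x y|k x y|d e].
- have [bl _] := @pure_bilinear R[i] (A ⊙ A) A.
  by rewrite bl /rev; do !rewrite linearP /=.
- by rewrite linearP (@pure_bilinear R[i] A (A ⊙ A)).2.
by rewrite /rev (tassocE d e c) !tflipE tmapE /= tflipE tassocE.
Qed.

Lemma counit_bilinear (eps : {scalar A}) :
  is_bilinear (fun b c : A => eps b *: c).
Proof.
split=> [c k b b'|b k c c'] /=; first by rewrite linearP scalerDl scalerA.
by rewrite scalerDr !scalerA mulrC.
Qed.

Lemma counit_bilinear' (eps : {scalar A}) :
  is_bilinear (fun b c : A => eps c *: b).
Proof. by have [bl br] := counit_bilinear eps; split=> [c|b]; [apply: br|apply: bl]. Qed.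

Lemma tlift_star (f : A -> A -> A) (x : A ⊙ A) : is_bilinear f ->
  star (tlift f (star x)) = tlift (fun b c => star (f (star b) (star c))) x.
Proof.
move=> bf; have [bl br] := bf.
have bf' : is_bilinear (fun b c => star (f (star b) (star c))).
  split=> [c k b b'|b k c c'] /=; rewrite starD starZ.
  - by rewrite bl starD starZ conjCK.
  - by rewrite br starD starZ conjCK.
move: x; apply: tensor_linear_ext.
- by move=> k x y; rewrite starD starZ (tlift_linear bf) starD starZ conjCK.
- exact: (tlift_linear bf').
by move=> a b; rewrite star_pure !tliftE.
Qed.

Lemma counit_star (a : A) : counit (star a) = (counit a)^*.
Proof.
pose eps (b : A) : R[i] := (counit (star b))^*.
have eps_lin : scalar eps.
  move=> k b c; rewrite /eps starD starZ linearP rmorphD.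
  by rewrite rmorphM /= conjCK.
pose eps' : {scalar A} := HB.pack eps (GRing.isLinear.Build _ _ _ _ eps eps_lin).
suff -> : counit a = eps' a by rewrite /= /eps conjCK.
have epsr b : tlift (fun c d => eps' d *: c) (comul b) = b.
  rewrite -[RHS]starK -[in RHS](counitr (star b)) comul_star.
  rewrite (tlift_star _ (counit_bilinear' _)).
  by apply: eq_tlift => c d; rewrite starZ starK.
rewrite -{1}(epsr a) -{2}(counitl a).
have bcf : is_bilinear (fun c d : A => counit c * eps' d : R[i]^o).
  split=> [d k c c'|c k d d'] /=.
  - by rewrite linearP mulrDl scalerAl.
  - by rewrite eps_lin mulrDr scalerAr.
transitivity (tlift (fun c d : A => counit c * eps' d : R[i]^o) (comul a)).
- rewrite /tlift /bisum raddf_sum; apply: eq_bigr => p _.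
  by rewrite /= linearZ /= mulrC.
- by rewrite /tlift /bisum raddf_sum; apply: eq_bigr => p _; rewrite [RHS]linearZ.
Qed.

Lemma cop_counit1 : cop_counit 1 = 1.
Proof. exact: counit1. Qed.

Lemma cop_counitM : {morph cop_counit : a b / a * b}.
Proof. by move=> a b; apply: counitM. Qed.

Lemma cop_counitl a :
  tlift (fun b c => cop_counit b *: c) (cop_comul a) = a.
Proof. by rewrite (tlift_flip _ (counit_bilinear counit)) counitr. Qed.

Lemma cop_counitr a :
  tlift (fun b c => cop_counit c *: b) (cop_comul a) = a.
Proof. by rewrite (tlift_flip _ (counit_bilinear' counit)) counitl. Qed.

Lemma antipode_bilinear (S : {linear A -> A}) :
  is_bilinear (fun b c : A => S b * c).
Proof.
split=> [c k b b'|b k c c'] /=; first by rewrite linearP mulrDl scalerAl.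
by rewrite mulrDr scalerAr.
Qed.

Lemma antipode_bilinear' (S : {linear A -> A}) :
  is_bilinear (fun b c : A => b * S c).
Proof.
split=> [c k b b'|b k c c'] /=; first by rewrite mulrDl scalerAl.
by rewrite linearP mulrDr scalerAr.
Qed.

Lemma cop_antipodel a :
  tlift (fun b c => cop_antipode b * c) (cop_comul a) = (cop_counit a)%:A.
Proof.
rewrite (tlift_flip _ (antipode_bilinear cop_antipode)).
transitivity (star (tlift (fun b c : A => b * antipode c) (star (comul (a : A))))).
  rewrite (tlift_star _ (antipode_bilinear' _)).
  by apply: eq_tlift => b c; rewrite starM starK.
by rewrite -comul_star antipoder starZ star1 counit_star conjCK.
Qed.

Lemma cop_antipoder a :
  tlift (fun b c => b * cop_antipode c) (cop_comul a) = (cop_counit a)%:A.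
Proof.
rewrite (tlift_flip _ (antipode_bilinear' cop_antipode)).
transitivity (star (tlift (fun b c : A => antipode b * c) (star (comul (a : A))))).
  rewrite (tlift_star _ (antipode_bilinear _)).
  by apply: eq_tlift => b c; rewrite starM starK.
by rewrite -comul_star antipodel starZ star1 counit_star conjCK.
Qed.

HB.instance Definition _ := isHopfStarAlgebra.Build R (cop A)
  cop_comul1 cop_comulM cop_comul_star cop_comulA cop_counit1 cop_counitM
  cop_counitl cop_counitr cop_antipodel cop_antipoder.

Lemma cop_unitary_corep n (u : 'M[A]_n) : unitary_corep u ->
  unitary_corep ((map_mx star u)^T : 'M[cop A]_n).
Proof.
move=> [uD uu uu']; split.
- move=> i j; rewrite !mxE -[LHS]/(tflip (comul (star (u j i)))).
  rewrite comul_star uD star_sum raddf_sum; apply: eq_bigr => k _.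
  by rewrite star_pure [LHS]tflipE !mxE.
- rewrite -[RHS]uu'; congr (_ *m _).
  by apply/matrixP => i j; rewrite !mxE starK.
- rewrite -[RHS]uu; congr (_ *m _).
  by apply/matrixP => i j; rewrite !mxE starK.
Qed.

End CopHopf.

Section CopCqg.
Variable A : cqgType R.

Lemma cop_coef_span (a : cop A) : exists s : seq (R[i] * cop A),
  (forall p, p \in s -> matrix_coef p.2) /\ a = \sum_(p <- s) p.1 *: p.2.
Proof.
have [s [sP aE]] := coef_span (star (a : A)).
exists [seq (p.1^*, star (p.2 : A) : cop A) | p <- s]; split.
  move=> _ /mapP[p ps ->] /=; have [n [u [i [j [uP ->]]]]] := sP _ ps.
  exists n, ((map_mx star u)^T), j, i; split; first exact: cop_unitary_corep.
  by rewrite !mxE.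
rewrite big_map -[LHS](starK (a : A)) aE star_sum.
by apply: eq_bigr => p _; rewrite starZ.
Qed.

Definition cop_haar (a : cop A) : R[i] := haar (a : A).
Lemma cop_haar_linear : scalar cop_haar.
Proof. by move=> k a b; rewrite /cop_haar linearP. Qed.
HB.instance Definition _ :=
  GRing.isLinear.Build R[i] (cop A) R[i] _ cop_haar cop_haar_linear.

Lemma cop_haar1 : cop_haar 1 = 1.
Proof. exact: haar1. Qed.
Lemma cop_haar_ge0 a : 0 <= cop_haar (star a * a).
Proof. exact: haar_ge0. Qed.
Lemma cop_haar_faithful a : cop_haar (star a * a) = 0 -> a = 0.
Proof. exact: haar_faithful. Qed.
Lemma cop_haar_invl a :
  tlift (fun b c => cop_haar b *: c) (comul a) = (cop_haar a)%:A.
Proof.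
by rewrite -[comul a]/(tflip (comul (a : A)))
  (tlift_flip _ (counit_bilinear haar)) haar_invr.
Qed.
Lemma cop_haar_invr a :
  tlift (fun b c => cop_haar c *: b) (comul a) = (cop_haar a)%:A.
Proof.
by rewrite -[comul a]/(tflip (comul (a : A)))
  (tlift_flip _ (counit_bilinear' haar)) haar_invl.
Qed.

HB.instance Definition _ := isCompactQuantumGroup.Build R (cop A)
  cop_coef_span cop_haar1 cop_haar_ge0 cop_haar_faithful cop_haar_invl
  cop_haar_invr.

End CopCqg.
End Cop.

Definition to_cop (A : Type) (a : A) : cop A := a.

Lemma to_cop_linear (R : realType) (A : starAlgType R) :
  linear (@to_cop A : A -> cop A).
Proof. by []. Qed.
HB.instance Definition _ (R : realType) (A : starAlgType R) :=
  GRing.isLinear.Build R[i] A (cop A) _ (@to_cop A) (@to_cop_linear R A).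

Definition comul_tilde (R : realType) (A : cqgType R) (a : A) : A ⊙ cop A :=
  tmap idfun (@to_cop A) (comul a).

(* The Haar state a ⊗ b |-> h(a) h(b) of the product of two compact quantum
   groups.                                                                   *)
Definition tensor_haar (R : realType) (A B : cqgType R) (x : A ⊙ B) : R[i] :=
  tlift (fun a b => haar a * haar b) x.

(* Positivity in a *-subalgebra B of T: finite sums of b^* b with b in B.    *)
Definition positive_in (R : realType) (T : starAlgType R) (B : set T) (x : T)
    : Prop :=
  exists s : seq T,
    (forall b, b \in s -> B b) /\ x = \sum_(b <- s) star b * b.

Definition expected (R : realType) (T : starAlgType R) (phi : T -> R[i])
    (B : set T) : Prop :=
  exists E : {linear T -> T},
    [/\ (forall x, E (E x) = E x) /\ range E = B,
        E 1 = 1,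
        forall x, positive_in setT x -> positive_in B (E x)
      & forall x, phi (E x) = phi x].

(* Main.v *)
(* Sums of squares make positivity algebraic. Write D for the map a |-> a_(1) ⊗ a_(2)
   from A to A ⊙ A^cop.

   If h is a trace, then S is a *-map and F(a ⊗ b) = h(a S(b_(1))) b_(2) is a
   left inverse of D with h F = h ⊗ h; moreover F(x^* x) = (h ⊗ id)(y^* y) with
   y = W x for W(a ⊗ b) = a S(b_(1)) ⊗ b_(2), and orthonormalizing the first
   leg of y turns this into a sum of squares. So D F is the projection.

   Conversely, let E be such a projection. Kadison's inequality
   (h ⊗ h)(E(x)^2) <= (h ⊗ h)(x^2) for self-adjoint x, applied to
   x = 1 ⊗ b + t E(1 ⊗ b) with t -> oo, gives E(1 ⊗ b) = h(b) 1. The counit is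
   a character, hence by Cauchy-Schwarz the state psi = (eps ⊗ eps) E satisfies
   psi(D(a) x) = eps(a) psi(x) = psi(x D(a)). Computing psi(a ⊗ b) on both sides
   yields h(b a) = h(S^2(a) b). As h S = h and S is antimultiplicative, this
   forces S^4 = 1, and then S^2 = 1 by positivity, so h is a trace. *)

From HB Require Import structures.
Require Import Defs.
From mathcomp Require Import all_boot all_order all_algebra.
From mathcomp Require Import complex ring.
From mathcomp Require Import boolp classical_sets reals.

Set Implicit Arguments.
Unset Strict Implicit.
Unset Printing Implicit Defensive.

Import Order.TTheory GRing.Theory Num.Theory.
Local Open Scope ring_scope.
Local Open Scope classical_set_scope.

Local Notation sos := (positive_in setT).

Lemma tlift_sum (K : fieldType) (U V W : lmodType K) (f : U -> V -> W)
    (I : Type) (r : seq I) (F : I -> U ⊙ V) : is_bilinear f ->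
  tlift f (\sum_(i <- r) F i) = \sum_(i <- r) tlift f (F i).
Proof.
move=> bf; pose fl := GRing.isLinear.Build _ _ _ _ (tlift f) (tlift_linear bf).
pose f' : {linear U ⊙ V -> W} := HB.pack (tlift f) fl.
by rewrite -[LHS]/(f' _) raddf_sum.
Qed.

(** * Counit and antipode on matrix coefficients *)

Section Coefficients.
Variables (R : realType) (A : hopfStarAlgType R).

Lemma corep_mulstar n (u : 'M[A]_n) i j : unitary_corep u ->
  \sum_k u i k * star (u j k) = (i == j)%:R.
Proof.
case=> _ uu _; have /matrixP/(_ i j) := uu; rewrite !mxE => <-.
by apply: eq_bigr => k _; rewrite !mxE.
Qed.

Lemma corep_starmul n (u : 'M[A]_n) i j : unitary_corep u ->
  \sum_k star (u k i) * u k j = (i == j)%:R.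
Proof.
case=> _ _ uu; have /matrixP/(_ i j) := uu; rewrite !mxE => <-.
by apply: eq_bigr => k _; rewrite !mxE.
Qed.

Lemma sum_delta_mul n (i : 'I_n) (a : 'I_n -> A) :
  \sum_k (i == k)%:R * a k = a i.
Proof.
rewrite (bigD1 i) //= eqxx mul1r big1 ?addr0 // => k /negPf.
by rewrite eq_sym => ->; rewrite mul0r.
Qed.

Lemma tlift_comul_coef (W : lmodType R[i]) (f : A -> A -> W) n (u : 'M[A]_n)
    i j : is_bilinear f -> unitary_corep u ->
  tlift f (comul (u i j)) = \sum_k f (u i k) (u k j).
Proof.
move=> bf [uD _ _]; rewrite uD tlift_sum //.
by apply: eq_bigr => k _; apply: tliftE.
Qed.

(** The counit axiom reads eps(u) u = u as a product of matrices; multiplying by the adjoint of u on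
    the right cancels u. *)
Lemma counit_coef n (u : 'M[A]_n) i j : unitary_corep u ->
  counit (u i j) = (i == j)%:R.
Proof.
move=> hu.
have uE l : \sum_k counit (u i k) *: u k l = u i l.
  rewrite -[RHS]counitl.
  by rewrite (tlift_comul_coef _ _ (counit_bilinear counit) hu).
have : (counit (u i j))%:A = ((i == j)%:R : A).
  rewrite -(corep_mulstar i j hu).
  under eq_bigr => l _ do rewrite -uE mulr_suml.
  rewrite exchange_big /=.
  under eq_bigr => k _.
    under eq_bigr => l _ do rewrite -scalerAl.
    rewrite -scaler_sumr corep_mulstar //; over.
  rewrite (bigD1 j) //= eqxx big1 ?addr0 // => k /negPf ->.
  by rewrite scaler0.
move/(congr1 counit); rewrite linearZ /= counit1 mulr1 => ->.
by rewrite -scaler_nat linearZ /= counit1 mulr1.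
Qed.

(** The antipode axiom makes S(u) a left inverse of u, and unitarity makes the adjoint of u a right
    inverse, so the two agree. *)
Lemma antipode_coef n (u : 'M[A]_n) i j : unitary_corep u ->
  antipode (u i j) = star (u j i).
Proof.
move=> hu.
have uE l : \sum_k antipode (u i k) * u k l = (i == l)%:R.
  rewrite -(tlift_comul_coef _ _ (antipode_bilinear antipode) hu) antipodel.
  by rewrite (counit_coef _ _ hu) -[RHS]scaler_nat.
transitivity (\sum_k antipode (u i k) * (\sum_l u k l * star (u j l))).
  under eq_bigr => k _ do rewrite corep_mulstar //.
  rewrite (bigD1 j) //= eqxx mulr1 big1 ?addr0 // => k /negPf ->.
  by rewrite mulr0.
under eq_bigr => k _ do rewrite mulr_sumr.
rewrite exchange_big /=.
under eq_bigr => l _.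
  under eq_bigr => k _ do rewrite mulrA.
  rewrite -mulr_suml uE; over.
exact: sum_delta_mul.
Qed.

End Coefficients.

(** * Hermitian functionals; the Haar state and the antipode *)

Section PositiveFunctional.
Variables (R : realType) (A : starAlgType R) (f : {scalar A}).
Hypothesis f_ge0 : forall a, 0 <= f (star a * a).

(** Polarization: f(b) + f(star b) is a real combination of values of f at squares, hence real. The
    cases b = a and b = i a together determine f(star a). *)
Lemma positive_star a : f (star a) = (f a)^*.
Proof.
have re b : (f b + f (star b))^* = f b + f (star b).
  apply/CrealP.
  have -> : f b + f (star b) =
      f (star (1 + b) * (1 + b)) - f (star 1 * 1) - f (star b * b).
    rewrite starD star1 mulrDl !mulrDr !mul1r mulr1 !linearD /=.
    by ring.
  by rewrite !rpredB // ger0_real.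
have e1 := re a; have e2 := re ('i *: a).
rewrite starZ conjCi !linearZ /= in e2.
move: e1 e2; move: (f a) (f (star a)) => x y.
rewrite !rmorphD !rmorphM /= rmorphN /= !conjCi => e1 e2.
have {}e2 : x^* - y^* = y - x.
  apply: (mulfI (neq0Ci R[i])); transitivity (- (- 'i * x^* + - - 'i * y^*)).
    by ring.
  by rewrite e2; ring.
apply: (mulfI (x := 2)); first by rewrite pnatr_eq0.
transitivity ((x + y) + (y - x)); first by ring.
by rewrite -e1 -e2; ring.
Qed.

End PositiveFunctional.

Section CoefSpan.
Variables (R : realType) (A : cqgType R).

Lemma coef_linear_ext (W : lmodType R[i]) (f g : A -> W) :
  linear f -> linear g ->
  (forall n (u : 'M[A]_n) i j, unitary_corep u -> f (u i j) = g (u i j)) ->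
  f =1 g.
Proof.
have sumE (h : A -> W) : linear h -> forall s : seq (R[i] * A),
    h (\sum_(p <- s) p.1 *: p.2) = \sum_(p <- s) p.1 *: h p.2.
  move=> lh s; pose hl := GRing.isLinear.Build _ _ _ _ h lh.
  pose h' : {linear A -> W} := HB.pack h hl.
  rewrite -[LHS]/(h' _) linear_sum.
  by apply: eq_bigr => p _; rewrite linearZ.
move=> lf lg fg a; have [s [sP ->]] := coef_span a.
rewrite !sumE // !big_seq; apply: eq_bigr => p /sP [n [u [i [j [hu ->]]]]].
by rewrite fg.
Qed.


Lemma sesqui_coef_ext (W : lmodType R[i]) (f g : A -> W) :
  (forall k a b, f (k *: a + b) = k^* *: f a + f b) ->
  (forall k a b, g (k *: a + b) = k^* *: g a + g b) ->
  (forall n (u : 'M[A]_n) i j, unitary_corep u -> f (u i j) = g (u i j)) ->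
  f =1 g.
Proof. exact: (@coef_linear_ext (conj_mod W)). Qed.

Lemma haar_star (a : A) : haar (star a) = (haar a)^*.
Proof. exact: (positive_star haar_ge0). Qed.

(** The matrix P = h(u) is Hermitian: invariance gives P u = P, so P equals P times the adjoint of
    u, and applying h shows that P equals P times its own adjoint. *)
Lemma haar_coef n (u : 'M[A]_n) i j : unitary_corep u ->
  haar (u i j) = (haar (u j i))^*.
Proof.
move=> hu.
have uE q l : \sum_k haar (u q k) *: u k l = (haar (u q l))%:A.
  rewrite -haar_invl.
  by rewrite (tlift_comul_coef _ _ (counit_bilinear haar) hu).
have PE k l : haar (u k l) = \sum_m haar (u k m) * (haar (u l m))^*.
  have : (haar (u k l))%:A = \sum_m haar (u k m) *: star (u l m).
    transitivity (\sum_q haar (u k q) *: (\sum_m u q m * star (u l m))).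
      rewrite (bigD1 l) //= corep_mulstar // eqxx big1 ?addr0 // => q /negPf ql.
      by rewrite corep_mulstar // ql scaler0.
    under eq_bigr => q _ do rewrite scaler_sumr.
    rewrite exchange_big /=; apply: eq_bigr => m _.
    under eq_bigr => q _ do rewrite scalerAl.
    by rewrite -mulr_suml uE -scalerAl mul1r.
  move/(congr1 haar); rewrite linearZ /= haar1 mulr1 => ->.
  rewrite linear_sum; apply: eq_bigr => m _.
  by rewrite linearZ /= haar_star.
rewrite PE [in RHS]PE rmorph_sum /=; apply: eq_bigr => m _.
by rewrite rmorphM /= conjCK mulrC.
Qed.

(** Again uniqueness of inverses, for the matrix with entries u_ij v_pq: S of it is a left inverse
    by the antipode axiom, and its adjoint is a right inverse because u and v are unitary. *)
Lemma antipodeM (a b : A) : antipode (a * b) = antipode b * antipode a.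
Proof.
move: a; apply: coef_linear_ext => [k a c|k a c|n1 u i j hu].
- by rewrite mulrDl -scalerAl linearP.
- by rewrite linearP mulrDr -scalerAr.
move: b; apply: coef_linear_ext => [k a c|k a c|n2 v p q hv].
- by rewrite mulrDr -scalerAr linearP.
- by rewrite linearP mulrDl -scalerAl.
have uv i' j' p' q' :
    \sum_k \sum_l antipode (u i' k * v p' l) * (u k j' * v l q') =
    ((i' == j')%:R * (p' == q')%:R : A).
  have := antipodel (u i' j' * v p' q'); rewrite counitM !counit_coef //.
  rewrite comulM; have [-> _ _] := hu; have [-> _ _] := hv.
  rewrite mulr_suml tlift_sum; last exact: antipode_bilinear.
  under eq_bigr => k _.
    rewrite mulr_sumr tlift_sum; last exact: antipode_bilinear.
    under eq_bigr => l _.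
      rewrite pureM tliftE; last exact: antipode_bilinear.
      over.
    over.
  by move=> ->; rewrite -natrM scaler_nat -natrM.
transitivity (\sum_k \sum_l antipode (u i k * v p l) *
    (\sum_m \sum_r u k m * v l r * (star (v q r) * star (u j m)))).
  have uvE k l :
      \sum_m \sum_r u k m * v l r * (star (v q r) * star (u j m)) =
      ((j == k)%:R * (q == l)%:R : A).
    under eq_bigr => m _.
      under eq_bigr => r _ do rewrite mulrA -[X in X * _]mulrA.
      rewrite -mulr_suml -mulr_sumr corep_mulstar //; over.
    under eq_bigr => m _ do rewrite mulr_natr mulrnAl.
    by rewrite sumrMnl corep_mulstar // eq_sym (eq_sym q) mulr_natr.
  under eq_bigr => k _ do under eq_bigr => l _ do rewrite uvE -natrM.
  rewrite (bigD1 j) //= (bigD1 q) //= !eqxx mulr1 !big1 ?addr0 //.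
    move=> k /negPf kj; rewrite big1 // => l _.
    by rewrite eq_sym kj mul0n mulr0.
  by move=> l /negPf lq; rewrite eq_sym lq muln0 mulr0.
under eq_bigr => k _.
  under eq_bigr => l _.
    rewrite mulr_sumr; under eq_bigr => m _ do rewrite mulr_sumr; over.
  rewrite exchange_big /=; under eq_bigr => m _ do rewrite exchange_big /=.
  over.
rewrite exchange_big /=; under eq_bigr => m _.
  rewrite exchange_big /=; under eq_bigr => r _.
    under eq_bigr => k _ do under eq_bigr => l _ do rewrite mulrA.
    under eq_bigr => k _ do rewrite -mulr_suml.
    rewrite -mulr_suml uv; over.
  over.
rewrite /= (bigD1 i) //= (bigD1 p) //= !eqxx !mul1r !big1 ?addr0.
- by rewrite !antipode_coef.
- move=> m /negPf mi; rewrite big1 // => r _.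
  by rewrite eq_sym mi !mul0r.
- by move=> r /negPf rp; rewrite eq_sym rp mulr0 mul0r.
Qed.

Lemma haar_antipode (a : A) : haar (antipode a) = haar a.
Proof.
move: a; apply: (@coef_linear_ext R[i]^o) => [k a c|k a c|n u i j hu].
- by rewrite !linearP.
- by rewrite linearP.
by rewrite (antipode_coef _ _ hu) haar_star [RHS]haar_coef.
Qed.

End CoefSpan.

(** * Sums of squares and algebraic boundedness *)

Lemma parity_ind (P : nat -> Prop) :
  P 0%N -> P 1%N -> (forall n, P n -> P n.+2) -> forall n, P n.
Proof.
move=> P0 P1 PS n; suff [] : P n /\ P n.+1 by [].
by elim: n => [|n [Pn Pn1]]; split=> //; apply: PS.
Qed.

(** Replaces limits n -> oo below. The order of [R[i]] is partial, but the cases n = 0 and n = 1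
    force K and d to be real, which reduces the claim to the Archimedean property of R. *)
Lemma complex_archi (R : realType) (d K : R[i]) :
  (forall n, d *+ n <= K) -> d <= 0.
Proof.
case: d K => [a b] [c e] h.
have := h 0%N; have := h 1%N; rewrite mulr0n mulr1n !lecE /= => /andP[/eqP be ac].
move=> /andP[/eqP e0 c0]; rewrite -be e0 eqxx /=.
rewrite leNgt; apply/negP => a0.
have ca : 0 <= c / a by rewrite divr_ge0 // ltW.
have := h (Num.bound (c / a)); rewrite -be e0.
rewrite -[Complex a 0]/(a%:C)%C -[Complex c 0]/(c%:C)%C -rmorphMn lecR -mulr_natr.
by rewrite mulrC -ler_pdivlMr // leNgt archi_boundP.
Qed.

Section SumsOfSquares.
Variables (R : realType) (T : starAlgType R).
Implicit Types (x y b : T) (k : R[i]).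

Lemma starN x : star (- x) = - star x.
Proof. by rewrite -scaleN1r starZ rmorphN1 scaleN1r. Qed.

Lemma starB x y : star (x - y) = star x - star y.
Proof. by rewrite starD starN. Qed.

Lemma star0 : star (0 : T) = 0.
Proof. by rewrite -(subrr 0) starB !subrr. Qed.

Lemma starMn x n : star (x *+ n) = star x *+ n.
Proof.
elim: n => [|n IH]; last by rewrite !mulrS starD IH.
by rewrite !mulr0n star0.
Qed.

Lemma sos0 : sos (0 : T).
Proof. by exists [::]; split=> //; rewrite big_nil. Qed.

Lemma sosD x y : sos x -> sos y -> sos (x + y).
Proof.
move=> [s [_ ->]] [t [_ ->]]; exists (s ++ t); split=> //.
by rewrite big_cat.
Qed.

Lemma sos_sum (I : Type) (r : seq I) (P : pred I) (F : I -> T) :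
  (forall i, P i -> sos (F i)) -> sos (\sum_(i <- r | P i) F i).
Proof. by move=> h; apply: (big_ind sos) => //; [apply: sos0|apply: sosD]. Qed.

Lemma sos_sq b : sos (star b * b).
Proof. by exists [:: b]; split=> //; rewrite big_seq1. Qed.

Lemma sos_conj b x : sos x -> sos (star b * x * b).
Proof.
move=> [s [_ ->]]; rewrite mulr_sumr mulr_suml; apply: sos_sum => c _.
by have := sos_sq (c * b); rewrite starM !mulrA.
Qed.

Lemma sosZ k x : 0 <= k -> sos x -> sos (k *: x).
Proof.
move=> k0 [s [_ ->]]; rewrite scaler_sumr; apply: sos_sum => c _.
have := sos_sq (sqrtC k *: c); rewrite starZ -scalerAl -scalerAr scalerA.
by rewrite (CrealP _) ?ger0_real ?sqrtC_ge0 // -expr2 sqrtCK.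
Qed.

Lemma sos_star x : sos x -> star x = x.
Proof.
move=> [s [_ ->]]; rewrite star_sum; apply: eq_bigr => c _.
by rewrite starM starK.
Qed.

Lemma positive_in_ge0 (B : set T) (f : {scalar T}) x :
  (forall a, 0 <= f (star a * a)) -> positive_in B x -> 0 <= f x.
Proof.
by move=> f0 [s [_ ->]]; rewrite linear_sum; apply: sumr_ge0 => c _.
Qed.

Lemma positive_in_sos (B : set T) x : positive_in B x -> sos x.
Proof. by move=> [s [_ ->]]; exists s. Qed.

(** A substitute for a C*-norm: M plays the role of a bound on the squared norm of a. *)
Definition bounded (a : T) :=
  exists2 M : R[i], 0 <= M & sos (M%:A - star a * a : T).

(** The parallelogram law, with the square of x - y as the remainder. *)
Lemma boundedD x y : bounded x -> bounded y -> bounded (x + y).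
Proof.
move=> [M M0 hM] [N N0 hN]; exists (2 * M + 2 * N).
  by rewrite addr_ge0 ?mulr_ge0.
have -> : (2 * M + 2 * N)%:A - star (x + y) * (x + y) =
    2 *: (M%:A - star x * x) + 2 *: (N%:A - star y * y)
    + star (x - y) * (x - y).
  have par : star (x + y) * (x + y) =
      2 *: (star x * x) + 2 *: (star y * y) - star (x - y) * (x - y).
    rewrite starB starD !mulrDl !mulrDr !mulNr !mulrN opprK.
    rewrite !scaler_nat !mulr2n !opprD !opprK.
    set p := star x * x; set q := star x * y; set r := star y * x.
    rewrite [RHS]addrACA; congr (_ + _); first by rewrite addrA addrK.
    by rewrite [r - _]addrC addrA addrK addrC.
  rewrite par !scalerBr scalerDl -!scalerA opprB opprD addrCA addrC.
  by rewrite addrACA.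
by apply: sosD; [apply: sosD; apply: sosZ|apply: sos_sq].
Qed.

Lemma boundedZ k x : bounded x -> bounded (k *: x).
Proof.
move=> [M M0 hM]; exists (k^* * k * M).
  by rewrite mulr_ge0 // mulrC mul_conjC_ge0.
have -> : star (k *: x) * (k *: x) = (k^* * k) *: (star x * x).
  by rewrite starZ -scalerAl -scalerAr scalerA.
rewrite -[X in X - _]scalerA -scalerBr.
by apply: sosZ => //; rewrite mulrC mul_conjC_ge0.
Qed.

Lemma boundedM x y : bounded x -> bounded y -> bounded (x * y).
Proof.
move=> [M M0 hM] [N N0 hN]; exists (M * N); first exact: mulr_ge0.
have -> : (M * N)%:A - star (x * y) * (x * y) =
    star y * (M%:A - star x * x) * y + M *: (N%:A - star y * y).
  rewrite starM mulrBr mulrBl -scalerAr mulr1 -scalerAl scalerBr scalerA.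
  by rewrite !mulrA [RHS]addrC -[RHS]addrA addKr.
by apply: sosD; [apply: sos_conj|apply: sosZ].
Qed.

Lemma bounded_sum (I : Type) (r : seq I) (F : I -> T) :
  (forall i, bounded (F i)) -> bounded (\sum_(i <- r) F i).
Proof.
move=> h; apply: (big_ind bounded) => //; last exact: boundedD.
by exists 0 => //; rewrite mulr0 scale0r subr0; apply: sos0.
Qed.

(** Completing the square: M + 1 + 2y = (M - x^2) + (1 + y)^2 for y = x and for y = -x. *)
Lemma bounded_selfadjoint x : bounded x -> star x = x ->
  exists M : R[i], [/\ 0 < M, sos (M%:A + x) & sos (M%:A - x)].
Proof.
move=> [M M0 hM] sx; exists (2^-1 * (M + 1)).
have c0 : 0 < 2^-1 :> R[i] by rewrite invr_gt0.
have M1 : 0 < M + 1 by rewrite ltr_wpDl.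
have sq y : star y = y -> y * y = x * x -> sos ((2^-1 * (M + 1))%:A + y).
  move=> sy yx; have -> : (2^-1 * (M + 1))%:A + y =
      2^-1 *: ((M%:A - star x * x) + star (1 + y) * (1 + y)).
    rewrite sx starD star1 sy mulrDl !mulrDr !mul1r mulr1 yx.
    have -> : M%:A - x * x + (1 + y + (y + x * x)) = (M + 1)%:A + 2 *: y.
      rewrite addrC [1 + y + _]addrA addrACA subrr addr0 addrC.
      by rewrite scalerDl scale1r scaler_nat mulr2n !addrA.
    by rewrite scalerDr !scalerA mulrDr mulVf ?scale1r ?pnatr_eq0.
  by apply: sosZ; [exact: ltW|apply: sosD => //; apply: sos_sq].
split; [exact: mulr_gt0|exact: sq|].
by apply: sq; rewrite ?mulrNN // starN sx.
Qed.

(** * Kadison's inequality for elements between 0 and 1 *)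

Section UnitInterval.
Variable x : T.
Hypotheses (x_sos : sos x) (x1_sos : sos (1 - x)).

Lemma comm_1B : GRing.comm x (1 - x).
Proof. by rewrite /GRing.comm mulrBr mulrBl mulr1 mul1r. Qed.

(** Conjugating by x or by y = 1 - x raises an exponent by two, so exponents 0 and 1 suffice. The
    one mixed case is x y = y x y + x y x, valid because x + y = 1. *)
Lemma sos_monomial i j : sos (x ^+ i * (1 - x) ^+ j).
Proof.
have cxy := comm_1B.
have sx := sos_star x_sos; have sy := sos_star x1_sos.
have xy1 : x + (1 - x) = 1 by rewrite addrC subrK.
move: x1_sos cxy sy xy1; move: (1 - x) => y y_sos cxy sy xy1.
have stepx (m l : nat) : sos (x ^+ m * y ^+ l) -> sos (x ^+ m.+2 * y ^+ l).
  move/(sos_conj x); rewrite sx -mulrA -mulrA -(commrX l cxy).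
  by rewrite [x ^+ m * _]mulrA -exprSr mulrA -exprS.
have stepy (m l : nat) : sos (x ^+ m * y ^+ l) -> sos (x ^+ m * y ^+ l.+2).
  move/(sos_conj y); rewrite sy mulrA (commrX m (commr_sym cxy)).
  by rewrite -!mulrA -exprSr -exprS.
move: i j; apply: parity_ind => [||i hi] j; last exact: stepx.
- move: j; apply: parity_ind => [||j]; last exact: stepy.
  + by have := sos_sq 1; rewrite star1 !expr0.
  + by rewrite expr0 mul1r expr1.
move: j; apply: parity_ind => [||j]; last exact: stepy.
- by rewrite expr0 mulr1 expr1.
rewrite !expr1.
have -> : x * y = star y * x * y + star x * y * x.
  by rewrite sx sy -cxy -mulrDr [y + x]addrC xy1 mulr1.
by apply: sosD; apply: sos_conj.
Qed.

(* The n-step Bernoulli words in x and 1 - x, with their number of x's: the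
   moments below are those of the binomial law, computed in the algebra. *)
Lemma bernoulli_moments n : exists s : seq (nat * (nat * nat)),
  let w p := x ^+ p.2.1 * (1 - x) ^+ p.2.2 in
  [/\ \sum_(p <- s) w p = 1, \sum_(p <- s) w p *+ p.1 = x *+ n
    & \sum_(p <- s) w p *+ p.1 ^ 2 = (x - x * x) *+ n + x * x *+ n ^ 2].
Proof.
elim: n => [|n [s /= [s0 s1 s2]]].
  by exists [:: (0, (0, 0))]%N; split; rewrite big_seq1 /= ?mulr1 ?mulr0n ?addr0.
exists ([seq (p.1.+1, (p.2.1.+1, p.2.2)) | p <- s] ++
        [seq (p.1, (p.2.1, p.2.2.+1)) | p <- s]) => /=.
pose w (p : nat * (nat * nat)) := x ^+ p.2.1 * (1 - x) ^+ p.2.2.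
have w1 p : x ^+ p.2.1.+1 * (1 - x) ^+ p.2.2 = x * w p.
  by rewrite exprS mulrA.
have w2 p : x ^+ p.2.1 * (1 - x) ^+ p.2.2.+1 = w p - x * w p.
  rewrite exprSr mulrA mulrBr mulr1 -/(w p); congr (_ - _).
  apply/esym/commrM; apply: commrX; [exact: commr_refl|exact: comm_1B].
split; rewrite big_cat !big_map /= -big_split /=.
- by rewrite -[RHS]s0; apply: eq_bigr => p _; rewrite w1 w2 addrC subrK.
- transitivity (\sum_(p <- s) (w p *+ p.1 + x * w p)).
    apply: eq_bigr => p _; rewrite w1 w2 mulrS mulrnBl addrC.
    by rewrite [x * _ + _]addrC addrA subrK.
  by rewrite big_split /= s1 -mulr_sumr s0 mulr1 -mulrSr.
transitivity (\sum_(p <- s) (w p *+ p.1 ^ 2 + (x * w p *+ p.1) *+ 2 + x * w p)).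
  apply: eq_bigr => p _; rewrite w1 w2 mulrnBl addrC.
  have -> : (p.1.+1 ^ 2 = p.1 ^ 2 + (p.1 * 2 + 1))%N.
    by rewrite -addn1 sqrnD muln1 exp1n [(2 * _)%N]mulnC addnAC addnA.
  by rewrite mulrnDr addrA subrK mulrnDr mulrnA mulr1n addrA.
rewrite !big_split /= s2.
under [X in X + X]eq_bigr => p _ do rewrite -mulrnAr.
rewrite -!mulr_sumr s1 s0 mulr1 mulrnAr.
have -> : (n.+1 ^ 2 = n ^ 2 + (n * 2 + 1))%N.
  by rewrite -addn1 sqrnD muln1 exp1n [(2 * _)%N]mulnC addnAC addnA.
rewrite !mulrnDr mulrnA mulr1n mulr2n [(x - _) *+ n.+1]mulrSr.
by rewrite -[X in _ + X = _](subrK (x * x)) -[X in X + _ = _]addrA addrACA !addrA.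
Qed.

(* Kadison's inequality through the binomial law of n steps: with m = E x and
   weights e = E (w p) summing to 1, the squares (v - n m) e (v - n m) sum to
   n E(x - x^2) + n^2 (E(x^2) - m^2); divide by n^2. *)
Lemma kadison_unit (E : {linear T -> T}) (f : {scalar T}) :
    E 1 = 1 -> (forall y, sos y -> sos (E y)) -> (forall y, f (E y) = f y) ->
    (forall a, 0 <= f (star a * a)) ->
  f (E x * E x) <= f (x * x).
Proof.
move=> E1 Es fE f0; set m := E x.
have sm : star m = m by apply/sos_star/Es.
rewrite -subr_le0; apply: (@complex_archi _ _ (f (x - x * x))) => n.
have [->|n0] := posnP n.
  rewrite mulr0n; apply: (positive_in_ge0 (B := setT)) => //.
  by have := sos_monomial 1 1; rewrite !expr1 mulrBr mulr1.
have [s [s0 s1 s2]] := bernoulli_moments n.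
set w := fun p : nat * (nat * nat) => x ^+ p.2.1 * (1 - x) ^+ p.2.2 in s0 s1 s2.
have e0 : \sum_(p <- s) E (w p) = 1 by rewrite -linear_sum s0.
have e1 : \sum_(p <- s) E (w p) *+ p.1 = m *+ n.
  by under eq_bigr => p _ do rewrite -raddfMn; rewrite -linear_sum s1 raddfMn.
have e2 : \sum_(p <- s) E (w p) *+ p.1 ^ 2 = E (x - x * x) *+ n + E (x * x) *+ n ^ 2.
  under eq_bigr => p _ do rewrite -raddfMn.
  by rewrite -linear_sum s2 linearD !raddfMn.
have : 0 <= \sum_(p <- s) f (star (p.1%:R - m *+ n) * E (w p) * (p.1%:R - m *+ n)).
  apply: sumr_ge0 => p _; apply: (positive_in_ge0 (B := setT)) => //.
  exact/sos_conj/Es/sos_monomial.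
rewrite -linear_sum.
have -> : \sum_(p <- s) star (p.1%:R - m *+ n) * E (w p) * (p.1%:R - m *+ n) =
   E (x - x * x) *+ n + (E (x * x) - m * m) *+ n ^ 2.
  transitivity (\sum_(p <- s) (E (w p) *+ p.1 ^ 2 - m *+ n * (E (w p) *+ p.1)
      - (E (w p) *+ p.1) * (m *+ n) + m *+ n * E (w p) * (m *+ n))).
    apply: eq_bigr => p _; rewrite starB !starMn sm star1 mulrBl !mulrBr.
    rewrite !mulrBl mulr_natl mulr_natr.
    move: (m *+ n) => M.
    by rewrite mulr_natr -mulrnA mulnn mulrnAr opprB [X in _ + X = _]addrC addrA.
  rewrite big_split /= !sumrB -mulr_sumr -!mulr_suml -mulr_sumr e0 e1 e2 mulr1.
  by rewrite subrK mulrnBl mulrnAl mulrnAr -mulrnA mulnn addrA.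
rewrite linearD !raddfMn /= fE [f (_ - m * m)]linearB /= fE.
rewrite -mulnn mulrnA -mulrnDl pmulrn_lge0 //.
by rewrite addrC -lerBlDl sub0r -mulNrn opprB.
Qed.

End UnitInterval.

(** With z = f(x d), positivity of f at star x - n z^* d leaves 2n |z|^2 <= f(x star x) for every n,
    since the term quadratic in n vanishes. *)
Lemma cauchy_schwarz0 (f : {scalar T}) d : (forall a, 0 <= f (star a * a)) ->
  f (star d * d) = 0 -> forall x, f (x * d) = 0.
Proof.
move=> f0 d0 x; set z := f (x * d).
have zC : f (star d * star x) = z^* by rewrite -starM positive_star.
suff z0 : z * z^* *+ 2 <= 0.
  rewrite pmulrn_lle0 // in z0.
  by apply/eqP; rewrite -mul_conjC_eq0 eq_le z0 mul_conjC_ge0.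
apply: (@complex_archi _ _ (f (x * star x))) => n.
have [k kE] : {k | k = n%:R * z^*} by exists (n%:R * z^*).
have := f0 (star x - k *: d).
have -> : star (star x - k *: d) * (star x - k *: d) =
    x * star x - k *: (x * d) - (k^* *: (star d * star x) - (k^* * k) *: (star d * d)).
  by rewrite starB starK starZ mulrBl !mulrBr -!scalerAl -!scalerAr scalerA.
have fZ c w : f (c *: w) = c * f w by exact: linearZ.
have kC : k^* = n%:R * z by rewrite kE rmorphM /= conjCK rmorph_nat.
rewrite !raddfB /= !fZ d0 zC -/z mulr0 !oppr0 addr0 kC kE.
have -> : f (x * star x) - n%:R * z^* * z - n%:R * z * z^* =
    f (x * star x) - z * z^* *+ 2 *+ n.
  rewrite -addrA -opprD -!mulrA -!mulrDr [z^* * z]mulrC mulr_natl.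
  by rewrite mulr2n.
by rewrite subr_ge0.
Qed.

(** * Positive unital maps: Kadison's inequality, orthogonality, multiplicative domain *)

Section PositiveProjection.
Variables (E : {linear T -> T}) (f : {scalar T}).
Hypotheses (E1 : E 1 = 1) (E_sos : forall y, sos y -> sos (E y)).

(** Rescale z to (M + z) / 2M, which lies between 0 and 1. The constant and linear terms match on
    both sides because E is unital and preserves f. *)
Lemma kadison z : (forall y, f (E y) = f y) ->
    (forall a, 0 <= f (star a * a)) -> bounded z -> star z = z ->
  f (E z * E z) <= f (z * z).
Proof.
move=> fE f0 bz sz; have [M [M0 h1 h2]] := bounded_selfadjoint bz sz.
have c0 : 0 <= (2 * M)^-1 by rewrite invr_ge0 mulr_ge0 // ltW.
have M20 : 2 * M != 0 by rewrite mulf_neq0 ?pnatr_eq0 ?gt_eqF.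
have [c cE] : {c | c = (2 * M)^-1} by exists (2 * M)^-1.
have := @kadison_unit (c *: (M%:A + z)) _ _ E f E1 E_sos fE f0.
have -> : 1 - c *: (M%:A + z) = c *: (M%:A - z).
  apply/eqP; rewrite subr_eq -scalerDr addrACA addNr addr0 -scalerDl scalerA.
  by rewrite cE -mulr2n -[M *+ 2]mulr_natl mulVf ?scale1r.
rewrite cE => /(_ (sosZ c0 h1) (sosZ c0 h2)).
rewrite linearZ /= linearD linearZ /= E1 -!scalerAl -!scalerAr !linearZ /=.
rewrite !mulrA ler_pM2l; last by rewrite mulr_gt0 ?invr_gt0 ?mulr_gt0.
have sqE y : f ((M%:A + y) * (M%:A + y)) =
    M * M * f 1 + M * f y *+ 2 + f (y * y).
  have -> : (M%:A + y) * (M%:A + y) = (M * M)%:A + (M *: y) *+ 2 + y * y.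
    rewrite mulrDl !mulrDr -!scalerAl -!scalerAr !mul1r mulr1 scalerA.
    by rewrite mulr2n !addrA.
  by rewrite !linearD !linearZ /= mulr2n.
by rewrite !sqE fE lerD2l.
Qed.

(** Put y = E x. Kadison's inequality at x + n y, whose cross terms vanish, reads (n+1)^2 f(y^2) <=
    f(x^2) + n^2 f(y^2), so (2n+1) f(y^2) stays bounded. *)
Lemma projection_orthogonal x : (forall y, f (E y) = f y) ->
    (forall a, 0 <= f (star a * a)) -> E (E x) = E x ->
    bounded x -> bounded (E x) -> star x = x -> star (E x) = E x ->
    f (x * E x) = 0 -> f (E x * x) = 0 ->
  f (E x * E x) = 0.
Proof.
move=> fE f0; set y := E x => Ey bx yb sx sy xy yx.
have y0 : 0 <= f (y * y) by rewrite -{1}sy f0.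
apply/eqP; rewrite eq_le y0 andbT.
apply: (@complex_archi _ _ (f (x * x))) => n.
have := @kadison (x + y *+ n) fE f0.
have sn : star (x + y *+ n) = x + y *+ n by rewrite starD starMn sx sy.
have bn : bounded (x + y *+ n).
  by apply: boundedD => //; rewrite -scaler_nat; apply: boundedZ.
move=> /(_ bn sn); rewrite linearD raddfMn /= Ey -/y -mulrS.
rewrite mulrnAl mulrnAr mulrDl !mulrDr !mulrnAl !mulrnAr !linearD !raddfMn /=.
rewrite xy yx !mul0rn add0r addr0 -!mulrnA !mulnn => h.
have nE : (n.+1 ^ 2 = (n * 2 + 1) + n ^ 2)%N.
  by rewrite addnC -addn1 sqrnD muln1 exp1n [(2 * _)%N]mulnC addnAC addnA.
rewrite nE mulrnDr lerD2r in h; apply: le_trans h.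
by apply: ler_wpMn2l => //; rewrite addn1 ltnW // ltnS leq_pmulr.
Qed.

(* psi = chi o E is a state whose restriction to the range of E is the
   character chi, so the range lies in the multiplicative domain of psi. *)
Lemma character_module (chi : {scalar T}) (d x : T) :
    (forall a b, chi (a * b) = chi a * chi b) -> chi 1 = 1 ->
    (forall a, chi (star a) = (chi a)^*) ->
    E d = d -> E (star d) = star d -> E (star d * d) = star d * d ->
  chi (E (x * d)) = chi (E x) * chi d.
Proof.
move=> chiM chi1 chi_star Ed Esd Edd.
pose psi y := chi (E y).
have psi_lin : scalar psi by move=> k a b; rewrite /psi !linearP.
pose psi' : {scalar T} := HB.pack psi (GRing.isLinear.Build _ _ _ _ psi psi_lin).
have chi_ge0 a : 0 <= chi (star a * a).
  by rewrite chiM chi_star mulrC mul_conjC_ge0.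
have psi_ge0 a : 0 <= psi' (star a * a).
  apply: (positive_in_ge0 (B := setT) (f := chi)) => //.
  exact/E_sos/sos_sq.
pose d' := d - (chi d)%:A.
have d0 : psi' (star d' * d') = 0.
  have -> : psi' (star d' * d') = chi (star d' * d').
    rewrite /= /psi; congr (chi _).
    rewrite /d' starB starZ star1 mulrBl !mulrBr -!scalerAl -!scalerAr.
    rewrite !mulr1 !mul1r !linearB /= !linearZ /= E1 Edd Ed Esd.
    by [].
  rewrite chiM; have -> : chi d' = 0.
    have chiZ c w : chi (c *: w) = c * chi w by exact: linearZ.
    by rewrite /d' raddfB /= chiZ chi1 mulr1 subrr.
  by rewrite mulr0.
have := cauchy_schwarz0 psi_ge0 d0 x.
have -> : x * d' = x * d - chi d *: x by rewrite mulrBr -scalerAr mulr1.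
rewrite /= addrC -scaleNr psi_lin mulNr addrC mulrC => /eqP.
by rewrite subr_eq0 => /eqP.
Qed.

End PositiveProjection.

End SumsOfSquares.

(** * Slice maps, product functionals and sums in tensor legs *)

Section Slice.
Variable K : fieldType.
Variables U V : lmodType K.

Lemma slice_bilinear (f : {scalar U}) : is_bilinear (fun (u : U) (v : V) => f u *: v).
Proof.
split=> [v k u u'|u k v v'] /=; first by rewrite linearP scalerDl scalerA.
by rewrite scalerDr !scalerA mulrC.
Qed.

Definition slice (f : {scalar U}) : U ⊙ V -> V := tlift (fun u v => f u *: v).

HB.instance Definition _ (f : {scalar U}) :=
  GRing.isLinear.Build K (U ⊙ V) V _ (slice f)
    (tlift_linear (slice_bilinear f)).

Lemma sliceE (f : {scalar U}) u v : slice f (u ⊗ v) = f u *: v.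
Proof. exact: tliftE (slice_bilinear f). Qed.

Definition tensor_functional (f : {scalar U}) (g : {scalar V}) (x : U ⊙ V) : K :=
  g (slice f x).

Lemma tensor_functional_linear f g : scalar (tensor_functional f g).
Proof. by move=> k x y; rewrite /tensor_functional !linearP. Qed.

HB.instance Definition _ (f : {scalar U}) (g : {scalar V}) :=
  GRing.isLinear.Build K (U ⊙ V) K _ (tensor_functional f g)
    (tensor_functional_linear f g).

Lemma tensor_functionalE f g u v :
  tensor_functional f g (u ⊗ v) = f u * g v.
Proof. by rewrite /tensor_functional sliceE linearZ. Qed.

End Slice.

Section PureTheory.
Variables (K : fieldType) (U V : lmodType K).
Implicit Types (u : U) (v : V).

Lemma pureDl u u' v : (u + u') ⊗ v = u ⊗ v + u' ⊗ v.
Proof.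
by have [bl _] := @pure_bilinear K U V; have := bl v 1 u u'; rewrite /= !scale1r.
Qed.

Lemma pureDr u v v' : u ⊗ (v + v') = u ⊗ v + u ⊗ v'.
Proof.
by have [_ br] := @pure_bilinear K U V; have := br u 1 v v'; rewrite /= !scale1r.
Qed.

Lemma pureZl k u v : (k *: u) ⊗ v = k *: (u ⊗ v).
Proof. by have [bl _] := @pure_bilinear K U V; apply: (scalable_linear (bl v)). Qed.

Lemma pureZr k u v : u ⊗ (k *: v) = k *: (u ⊗ v).
Proof. by have [_ br] := @pure_bilinear K U V; apply: (scalable_linear (br u)). Qed.

Lemma pure0l v : (0 : U) ⊗ v = 0.
Proof. by rewrite -(scale0r 0) pureZl scale0r. Qed.

Lemma pure0r u : u ⊗ (0 : V) = 0.
Proof. by rewrite -(scale0r 0) pureZr scale0r. Qed.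

Lemma pure_suml (I : Type) (r : seq I) (F : I -> U) v :
  (\sum_(i <- r) F i) ⊗ v = \sum_(i <- r) F i ⊗ v.
Proof.
apply: (big_morph (fun u => u ⊗ v)) => [u u'|]; first exact: pureDl.
exact: pure0l.
Qed.

Lemma pure_sumr (I : Type) (r : seq I) u (F : I -> V) :
  u ⊗ (\sum_(i <- r) F i) = \sum_(i <- r) u ⊗ F i.
Proof.
apply: (big_morph (fun v => u ⊗ v)) => [v v'|]; first exact: pureDr.
exact: pure0r.
Qed.

End PureTheory.

(** * Positivity of the Haar slice and boundedness in tensor products *)

Section OrthonormalTensor.
Variables (R : realType) (A : cqgType R) (B : starAlgType R).

(** Gram-Schmidt on the first legs for the inner product h(star a b); faithfulness of h allows a
    nonzero remainder to be normalized. *)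
Lemma orthonormal_tensor (x : A ⊙ B) :
  exists n (e : 'I_n -> A) (c : 'I_n -> B),
    (forall i j, haar (star (e i) * e j) = (i == j)%:R) /\
    x = \sum_i e i ⊗ c i.
Proof.
have [s ->] : exists s, x = \sum_(p <- s) p.1 ⊗ p.2.
  by exists (repr x); rewrite {1}[x]tensorE.
elim: s => [|[a b] s [n [e [c [eo sE]]]]].
  exists 0%N, (fun=> 0), (fun=> 0); split; first by case.
  by rewrite big_nil big_ord0.
rewrite big_cons sE {s sE} /=.
(* r is the component of a orthogonal to all [e i]; if it vanishes, the family need not grow. *)
pose k i := haar (star (e i) * a); pose r := a - \sum_i k i *: e i.
have aE : a ⊗ b = r ⊗ b + \sum_i e i ⊗ (k i *: b).
  rewrite -{1}[a](subrK (\sum_i k i *: e i)) pureDl pure_suml; congr (_ + _).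
  by apply: eq_bigr => i _; rewrite pureZl pureZr.
have er i : haar (star (e i) * r) = 0.
  rewrite /r mulrBr mulr_sumr raddfB raddf_sum /= (bigD1 i) //= big1 => [|j /negPf ji].
    by rewrite -scalerAr linearZ /= eo eqxx mulr1 addr0 subrr.
  by rewrite -scalerAr linearZ /= eo eq_sym ji mulr0.
have [r0|r0] := eqVneq r 0.
  exists n, e, (fun i => k i *: b + c i); split=> //.
  under [RHS]eq_bigr => i _ do rewrite pureDr.
  rewrite big_split /= aE r0; congr (_ + _).
  by rewrite pure0l add0r.
pose q := sqrtC (haar (star r * r)).
have qq : q * q = haar (star r * r) by rewrite -expr2 sqrtCK.
have q0 : q != 0.
  by rewrite sqrtC_eq0; apply/eqP => /haar_faithful/eqP; rewrite (negPf r0).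
have qR : q^* = q by apply/CrealP; rewrite ger0_real // sqrtC_ge0 haar_ge0.
have qiR : (q^-1)^* = q^-1 by rewrite fmorphV /= qR.
(* The normalized remainder is prepended at index 0, and its norm q moves to the second leg. *)
exists n.+1, (fun i => oapp e (q^-1 *: r) (unlift ord0 i)),
  (fun i => oapp (fun i => k i *: b + c i) (q *: b) (unlift ord0 i)); split.
  move=> i j; case: (unliftP ord0 i) => [i'|] ->; case: (unliftP ord0 j) => [j'|] -> /=.
  - by rewrite eo (inj_eq (@lift_inj _ _)).
  - by rewrite -scalerAr linearZ /= er mulr0.
  - rewrite starZ -scalerAl linearZ /= -[star r * _]starK starM starK haar_star.
    by rewrite er rmorph0 mulr0.
  - rewrite starZ -scalerAl -scalerAr scalerA linearZ /= -qq qiR.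
    by rewrite -mulrA mulKf // mulVf.
rewrite big_ord_recl unlift_none /= aE -addrA -big_split /=; congr (_ + _).
  by rewrite pureZl pureZr scalerA mulVf // scale1r.
by apply: eq_bigr => i _; rewrite liftK /= pureDr.
Qed.

(** In an orthonormal expansion of x only the diagonal terms survive, leaving the sum of the star (c
    i) c i. *)
Lemma slice_haar_sos (x : A ⊙ B) : sos (slice haar (star x * x)).
Proof.
have [n [e [c [eo ->]]]] := orthonormal_tensor x.
rewrite star_sum mulr_suml raddf_sum; apply: sos_sum => i _.
rewrite mulr_sumr raddf_sum (bigD1 i) //= big1 => [|j /negPf ij].
  rewrite addr0 [star _]tensor_starE pureM [slice _ _]sliceE eo eqxx scale1r.
  exact: sos_sq.
by rewrite [star _]tensor_starE pureM [slice _ _]sliceE eo eq_sym ij scale0r.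
Qed.

End OrthonormalTensor.

Section StarTensor.
Variables (R : realType) (A B : starAlgType R).

Lemma star_tensor (a : A) (b : B) : star (a ⊗ b) = star a ⊗ star b.
Proof. exact: tensor_starE. Qed.

Lemma sos_tensorl (a : A) : sos a -> sos (a ⊗ 1 : A ⊙ B).
Proof.
move=> [s [_ ->]]; rewrite pure_suml; apply: sos_sum => c _.
by have := sos_sq (c ⊗ 1 : A ⊙ B); rewrite star_tensor pureM star1 mulr1.
Qed.

Lemma sos_tensorr (b : B) : sos b -> sos (1 ⊗ b : A ⊙ B).
Proof.
move=> [s [_ ->]]; rewrite pure_sumr; apply: sos_sum => c _.
by have := sos_sq (1 ⊗ c : A ⊙ B); rewrite star_tensor pureM star1 mulr1.
Qed.

Lemma bounded_tensor (a : A) (b : B) :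
  bounded a -> bounded b -> bounded (a ⊗ b : A ⊙ B).
Proof.
move=> [M M0 hM] [N N0 hN].
have -> : a ⊗ b = (a ⊗ 1) * (1 ⊗ b) :> A ⊙ B by rewrite pureM mulr1 mul1r.
apply: boundedM.
- exists M => //; have := sos_tensorl hM; congr sos.
  rewrite -scaleN1r pureDl !pureZl scaleN1r star_tensor pureM star1 mulr1.
  by [].
- exists N => //; have := sos_tensorr hN; congr sos.
  rewrite -scaleN1r pureDr !pureZr scaleN1r star_tensor pureM star1 mulr1.
  by [].
Qed.

End StarTensor.

Section CqgBounded.
Variables (R : realType).

(** The squares in a column of u sum to 1, so 1 minus one of them is the sum of the others. *)
Lemma coef_bounded (A : hopfStarAlgType R) n (u : 'M[A]_n) i j :
  unitary_corep u -> bounded (u i j).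
Proof.
move=> hu; exists 1; rewrite // scale1r.
have := corep_starmul j j hu; rewrite eqxx mulr1n => <-.
rewrite (bigD1 i) //= addrAC subrr add0r; apply: sos_sum => k _.
exact: sos_sq.
Qed.

Lemma cqg_bounded (A : cqgType R) (a : A) : bounded a.
Proof.
have [s [sP ->]] := coef_span a; rewrite big_seq.
apply: (big_ind (@bounded R A)) => [||p /sP [n [u [i [j [hu ->]]]]]].
- by exists 0 => //; rewrite mulr0 scale0r subr0; apply: sos0.
- exact: boundedD.
- exact/boundedZ/coef_bounded.
Qed.

Lemma tensor_bounded (A B : cqgType R) (x : A ⊙ B) : bounded x.
Proof.
rewrite [x]tensorE; apply: bounded_sum => p.
by apply: bounded_tensor; apply: cqg_bounded.
Qed.

End CqgBounded.

(** * The embedding of A and the states h ⊗ h and eps ⊗ eps *)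

Section DeltaTilde.
Variables (R : realType) (A : cqgType R).
Local Notation D := (@comul_tilde R A).
Local Notation T := (A ⊙ cop A).
Implicit Types (a b c : A) (x y : T).

(** As [cop A] is convertible to [A], relabelling the second leg changes nothing and facts about
    [comul] transfer. *)
Lemma comul_tildeE a : D a = (comul a : T).
Proof. exact: esym (tensorE _). Qed.

Lemma comul_tilde_linear : linear D.
Proof. by move=> k a b; rewrite !comul_tildeE linearP. Qed.

HB.instance Definition _ :=
  GRing.isLinear.Build R[i] A T _ D comul_tilde_linear.

Lemma comul_tilde1 : D 1 = 1.
Proof. by rewrite comul_tildeE comul1. Qed.

Lemma comul_tildeM a b : D (a * b) = D a * D b.
Proof. by rewrite !comul_tildeE comulM. Qed.

Lemma comul_tilde_star a : D (star a) = star (D a).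
Proof. by rewrite !comul_tildeE comul_star. Qed.

(** [tensor_haar] rebuilt as h applied to a slice: linearity comes bundled, and positivity reduces
    to [slice_haar_sos]. *)
Definition haar2 : T -> R[i] := tensor_functional haar haar.
HB.instance Definition _ := GRing.Linear.on haar2.

Lemma tensor_haarE x : tensor_haar x = haar2 x.
Proof.
have bh : is_bilinear (fun (a : A) (b : cop A) => haar a * haar b : R[i]^o).
  split=> [b k u u'|a k u u'] /=; first by rewrite linearP mulrDl scalerAl.
  by rewrite linearP mulrDr scalerAr.
move: x; apply: (@tensor_linear_ext _ _ _ R[i]^o) => [|k x y|a b].
- exact: tlift_linear bh.
- by rewrite linearP.
- by rewrite [LHS](tliftE _ _ bh) [RHS]tensor_functionalE.
Qed.

Lemma haar2_ge0 x : 0 <= haar2 (star x * x).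
Proof.
apply: (positive_in_ge0 (B := setT) (f := haar)); first exact: haar_ge0.
exact: slice_haar_sos.
Qed.

Lemma haar2_comul_tilde c : haar2 (D c) = haar c.
Proof.
rewrite comul_tildeE /haar2 /tensor_functional [slice _ _]haar_invl.
by rewrite linearZ /= haar1 mulr1.
Qed.

Lemma haar2_mul1l b x : haar2 ((1 ⊗ to_cop b) * x) = haar (b * slice haar x).
Proof.
move: x; apply: (@tensor_linear_ext _ _ _ R[i]^o) => [k x y|k x y|a c].
- by rewrite mulrDr -scalerAr !linearP.
- by rewrite linearP mulrDr -scalerAr linearP.
rewrite pureM mul1r [LHS]tensor_functionalE sliceE -scalerAr linearZ.
by [].
Qed.

Lemma haar2_mul1r b x : haar2 (x * (1 ⊗ to_cop b)) = haar (slice haar x * b).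
Proof.
move: x; apply: (@tensor_linear_ext _ _ _ R[i]^o) => [k x y|k x y|a c].
- by rewrite mulrDl -scalerAl !linearP.
- by rewrite linearP mulrDl -scalerAl linearP.
rewrite pureM mulr1 [LHS]tensor_functionalE sliceE -scalerAl linearZ.
by [].
Qed.

(** Combined with [haar2_mul1l] and [haar2_mul1r], this makes 1 ⊗ b orthogonal to the range of [D]
    when h(b) = 0. *)
Lemma slice_comul_tilde c : slice haar (D c) = (haar c)%:A.
Proof. by rewrite comul_tildeE [slice _ _]haar_invl. Qed.

Definition counit2 : T -> R[i] := tensor_functional counit counit.
HB.instance Definition _ := GRing.Linear.on counit2.

Lemma counit2_1 : counit2 1 = 1.
Proof. by rewrite [LHS]tensor_functionalE !counit1 mulr1. Qed.

Lemma counit2M x y : counit2 (x * y) = counit2 x * counit2 y.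
Proof.
move: x; apply: (@tensor_linear_ext _ _ _ R[i]^o) => [k x z|k x z|a b].
- by rewrite mulrDl -scalerAl linearP.
- by rewrite linearP mulrDl scalerAl.
move: y; apply: (@tensor_linear_ext _ _ _ R[i]^o) => [k x z|k x z|a' b'].
- by rewrite mulrDr -scalerAr linearP.
- by rewrite linearP mulrDr scalerAr.
rewrite pureM ![counit2 _]tensor_functionalE !counitM.
by rewrite mulrACA.
Qed.

Lemma counit2_star x : counit2 (star x) = (counit2 x)^*.
Proof.
move: x; apply: (@tensor_linear_ext _ _ _ (conj_mod R[i]^o)) => [k x z|k x z|a b].
- by rewrite starD starZ linearP.
- by rewrite linearP rmorphD rmorphM.
by rewrite star_tensor ![counit2 _]tensor_functionalE !counit_star rmorphM.
Qed.

Lemma counit2_comul_tilde c : counit2 (D c) = counit c.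
Proof.
by rewrite comul_tildeE /counit2 /tensor_functional [slice _ _]counitl.
Qed.

End DeltaTilde.

(** * From an expectation to the trace property *)

Section ExpectedKac.
Variables (R : realType) (A : cqgType R).
Local Notation D := (@comul_tilde R A).
Local Notation T := (A ⊙ cop A).
Local Notation haar2 := (@haar2 R A).
Local Notation counit2 := (@counit2 R A).
Variable E : {linear T -> T}.
Hypotheses (EE : forall x, E (E x) = E x) (rE : range E = range D).
Hypothesis E1 : E 1 = 1.
Hypothesis E_pos : forall x, sos x -> positive_in (range D) (E x).
Hypothesis haar2E : forall x, haar2 (E x) = haar2 x.
Implicit Types (a b c : A) (x y : T).

Let E_sos x : sos x -> sos (E x).
Proof. by move/E_pos/positive_in_sos. Qed.

Let E_D c : E (D c) = D c.
Proof.
have : range D (D c) by exists c.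
by rewrite -rE => -[x _ <-].
Qed.

Let E_range x : exists c, E x = D c.
Proof.
have : range E (E x) by exists x.
by rewrite rE => -[c _ <-]; exists c.
Qed.

(** Some M + x is a sum of squares, so its image M + E x is self-adjoint, and M is real. *)
Let E_selfadjoint x : star x = x -> star (E x) = E x.
Proof.
move=> sx; have [M [M0 h _]] := bounded_selfadjoint (tensor_bounded x) sx.
have := sos_star (E_sos h); rewrite linearD linearZ /= E1 starD starZ star1.
by rewrite (CrealP (gtr0_real M0)) => /addrI.
Qed.

(** Here 1 ⊗ b is orthogonal to the range of E, so E(1 ⊗ b) = D c has zero norm, and faithfulness of
    h on A gives c = 0. *)
Let E_1pure_centered b : star b = b -> haar b = 0 ->
  E (1 ⊗ to_cop b) = 0.
Proof.
move=> sb hb; pose x : T := 1 ⊗ to_cop b.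
have sx : star x = x by rewrite star_tensor star1 /to_cop [star _]sb.
have [c Ec] := E_range x.
have xc : haar2 (x * E x) = 0.
  by rewrite Ec haar2_mul1l slice_comul_tilde -scalerAr mulr1 linearZ /= hb mulr0.
have cx : haar2 (E x * x) = 0.
  by rewrite Ec haar2_mul1r slice_comul_tilde -scalerAl mul1r linearZ /= hb mulr0.
have : haar2 (E x * E x) = 0.
  exact: (projection_orthogonal (f := GRing.Linear.clone _ _ _ _ haar2 _)
    E1 E_sos haar2E (@haar2_ge0 _ A) (EE x) (tensor_bounded _)
    (tensor_bounded _) sx (E_selfadjoint sx) xc cx).
rewrite -{1}(E_selfadjoint sx) Ec -comul_tilde_star.
rewrite -comul_tildeM haar2_comul_tilde => /haar_faithful ->.
by rewrite raddf0.
Qed.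

Let E_1pure_selfadjoint b : star b = b ->
  E (1 ⊗ to_cop b) = (haar b)%:A.
Proof.
move=> sb; have hb : (haar b)^* = haar b by rewrite -haar_star sb.
have sb0 : star (b - (haar b)%:A) = b - (haar b)%:A.
  by rewrite starB starZ star1 sb hb.
have hb0 : haar (b - (haar b)%:A) = 0.
  by rewrite raddfB /= linearZ /= haar1 mulr1 subrr.
have := E_1pure_centered sb0 hb0; rewrite addrC -scaleNr pureDr pureZr.
rewrite linearD linearZ /= E1 scaleNr addrC => /eqP.
by rewrite subr_eq0 => /eqP.
Qed.

Let E_1pure b : E (1 ⊗ to_cop b) = (haar b)%:A.
Proof.
(* Real and imaginary parts: b = b1 + i b2. *)
pose b1 := 2^-1 *: (b + star b); pose b2 := (2 * 'i)^-1 *: (b - star b).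
have s1 : star b1 = b1.
  by rewrite starZ starD starK [star b + b]addrC fmorphV rmorph_nat.
have s2 : star b2 = b2.
  have ci : ((2 * 'i)^-1)^* = - (2 * 'i)^-1 :> R[i].
    by rewrite fmorphV rmorphM /= rmorph_nat conjCi mulrN invrN.
  rewrite starZ starB starK ci.
  by rewrite scaleNr -scalerN opprB.
have -> : b = b1 + 'i *: b2.
  rewrite /b1 /b2 scalerA invfM mulrCA mulfV ?neq0Ci // mulr1 -scalerDr.
  rewrite addrACA subrr addr0 -mulr2n -[b *+ 2]scaler_nat scalerA mulVf ?scale1r //.
  by rewrite pnatr_eq0.
clearbody b1 b2.
rewrite -[to_cop _]/(to_cop b1 + 'i *: to_cop b2) pureDr pureZr linearD linearZ /=.
have -> : haar (b1 + 'i *: b2) = haar b1 + 'i * haar b2.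
  by rewrite raddfD /= linearZ.
by rewrite !E_1pure_selfadjoint // scalerDl -scalerA.
Qed.

Let psi x := counit2 (E x).

Let psi_linear : scalar psi.
Proof. by move=> k a b; rewrite /psi !linearP. Qed.

HB.instance Definition _ := GRing.isLinear.Build R[i] T R[i] _ psi psi_linear.

Let psi_mulr x c : psi (x * D c) = psi x * counit c.
Proof.
rewrite /psi (character_module E1 E_sos x (counit2M (A := A)) (counit2_1 A)
  (counit2_star (A := A))).
- by congr (_ * _); apply: counit2_comul_tilde.
- exact: E_D.
- by rewrite -comul_tilde_star E_D.
- by rewrite -comul_tilde_star -comul_tildeM E_D.
Qed.

(** The adjoint of [psi_mulr], since psi is positive and hence Hermitian. *)
Let psi_mull x c : psi (D c * x) = counit c * psi x.
Proof.
pose psi' : {scalar T} := GRing.Linear.clone _ _ _ _ psi _.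
have psi_ge0 y : 0 <= psi' (star y * y).
  apply: (positive_in_ge0 (B := setT)
    (f := GRing.Linear.clone _ _ _ _ counit2 _)).
    by move=> y'; rewrite /= counit2M counit2_star mulrC mul_conjC_ge0.
  exact/E_sos/sos_sq.
have psi_star y : psi (star y) = (psi y)^* by exact: (positive_star psi_ge0).
rewrite -[D c * x]starK starM -comul_tilde_star psi_star psi_mulr counit_star.
by rewrite psi_star rmorphM /= !conjCK mulrC.
Qed.

Let psi_1pure b : psi (1 ⊗ to_cop b) = haar b.
Proof. by rewrite /psi E_1pure linearZ /= counit2_1 mulr1. Qed.

(** Unitarity writes u_ij ⊗ b as the sum over k of D(u_ik) (1 ⊗ star(u_jk) b); [psi_mull] keeps only
    k = i. *)
Let psi_coef n (u : 'M[A]_n) i j b : unitary_corep u ->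
  psi (u i j ⊗ to_cop b) = haar (antipode (u i j) * b).
Proof.
move=> hu; rewrite antipode_coef //.
have uE m : \sum_k u m k * (star (u j k) * b) = (m == j)%:R * b.
  under eq_bigr => k _ do rewrite mulrA.
  by rewrite -mulr_suml corep_mulstar.
have -> : u i j ⊗ to_cop b =
    \sum_k D (u i k) * (1 ⊗ to_cop (star (u j k) * b)) :> T.
  transitivity (\sum_m u i m ⊗ to_cop (\sum_k u m k * (star (u j k) * b)) : T).
    rewrite (bigD1 j) //= [X in _ + X]big1 => [|m /negPf mj].
      by rewrite uE eqxx mul1r addr0.
    by rewrite uE mj mul0r [LHS]pure0r.
  under eq_bigr => m _ do rewrite [_ ⊗ _](@pure_sumr _ A (cop A)).
  rewrite exchange_big /=; apply: eq_bigr => k _.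
  rewrite comul_tildeE; have [-> _ _] := hu; rewrite mulr_suml.
  by apply: eq_bigr => m _; rewrite pureM mulr1.
rewrite raddf_sum (bigD1 i) //= big1 => [|k /negPf ki].
  by rewrite addr0 psi_mull counit_coef // eqxx mul1r psi_1pure.
by rewrite psi_mull counit_coef // eq_sym ki mul0r.
Qed.

(** Dually, 1 ⊗ b u_ji is the sum over k of (star(u_kj) ⊗ b) D(u_ki), and [psi_mulr] keeps only k =
    i. *)
Let psi_star_coef n (u : 'M[A]_n) i j b : unitary_corep u ->
  psi (star (u i j) ⊗ to_cop b) = haar (b * u j i).
Proof.
move=> hu.
have uE m : \sum_k star (u k j) * u k m = (j == m)%:R.
  exact: corep_starmul.
have bE : 1 ⊗ to_cop (b * u j i) =
    \sum_k (star (u k j) ⊗ to_cop b) * D (u k i) :> T.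
  transitivity (\sum_m (\sum_k star (u k j) * u k m) ⊗ to_cop (b * u m i) : T).
    rewrite (bigD1 j) //= [X in _ + X]big1 => [|m /negPf mj].
      by rewrite uE eqxx addr0.
    by rewrite uE eq_sym mj pure0l.
  under eq_bigr => m _ do rewrite pure_suml.
  rewrite exchange_big /=; apply: eq_bigr => k _.
  rewrite comul_tildeE; have [-> _ _] := hu; rewrite mulr_sumr.
  by apply: eq_bigr => m _; rewrite pureM.
rewrite -psi_1pure bE raddf_sum (bigD1 i) //= big1 => [|k /negPf ki].
  by rewrite addr0 psi_mulr counit_coef // eqxx mulr1.
by rewrite psi_mulr counit_coef // ki mulr0.
Qed.

(** Both sides are psi(S(a) ⊗ b): [psi_coef] extends linearly to all first legs, while for a = u_ij
    the element S(a) = star(u_ji) falls under [psi_star_coef]. *)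
Lemma haar_modular a b : haar (b * a) = haar (antipode (antipode a) * b).
Proof.
have psiE c d : psi (c ⊗ to_cop d) = haar (antipode c * d).
  move: c; apply: (@coef_linear_ext _ _ R[i]^o) => [k a' b'|k a' b'|n u i j hu].
  - by rewrite pureDl pureZl /psi !linearP.
  - by rewrite linearP mulrDl -scalerAl linearP.
  exact: psi_coef.
rewrite -psiE.
move: a; apply: (@coef_linear_ext _ _ R[i]^o) => [k a' b'|k a' b'|n u i j hu].
- by rewrite mulrDr -scalerAr linearP.
- by rewrite linearP pureDl pureZl /psi !linearP.
by rewrite antipode_coef // psi_star_coef.
Qed.

(* The square of the antipode is the modular automorphism of h, which is
   inverted by the antipode: hence S^4 = 1, and S^2 = 1 because a modular
   automorphism does not have the eigenvalue -1. *)
Lemma expected_kac : kac_type A.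
Proof.
pose S2 a : A := antipode (antipode a).
have mod a b : haar (b * a) = haar (S2 a * b) := haar_modular a b.
(* h(b a) = h(S(a) S(b)) = h(S(S^2(b)) S(a)) = h(a S^2(b)), and modularity applies once more. *)
have hS2 a b : haar (b * a) = haar (S2 (S2 b) * a).
  rewrite -[LHS]haar_antipode antipodeM [LHS]mod.
  rewrite -[S2 (antipode b)]/(antipode (S2 b)).
  by rewrite -antipodeM [LHS]haar_antipode [LHS]mod.
have S4 b : S2 (S2 b) = b.
  apply/esym/eqP; rewrite -subr_eq0; apply/eqP.
  set d := b - S2 (S2 b).
  have d0 a : haar (d * a) = 0 by rewrite mulrBl raddfB /= -hS2 subrr.
  suff sd : star d = 0 by rewrite -[d]starK sd star0.
  by apply: haar_faithful; rewrite starK d0.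
have S2E b : S2 b = b.
  pose d := b - S2 b.
  have S2B a c : S2 (a - c) = S2 a - S2 c by rewrite /S2 !raddfB.
  have Sd : S2 d = - d by rewrite /d S2B S4 opprB.
  apply/esym/eqP; rewrite -subr_eq0; apply/eqP/haar_faithful; rewrite -/d.
  (* Modularity and S^2(d) = -d give h(star d d) = -h(d star d), which is at most 0. *)
  apply/eqP; rewrite eq_le haar_ge0 andbT mod Sd mulNr raddfN oppr_le0.
  by rewrite -{1}[d]starK haar_ge0.
by move=> a b; rewrite mod S2E.
Qed.

End ExpectedKac.

(** * From the trace property to an expectation *)

Section KacExpected.
Variables (R : realType) (A : cqgType R).
Local Notation D := (@comul_tilde R A).
Local Notation T := (A ⊙ cop A).
Implicit Types (a b c : A) (x y : T).

Lemma antipode1 : antipode (1 : A) = 1.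
Proof.
have := antipodel (1 : A); rewrite comul1 counit1 scale1r.
by rewrite (tliftE _ _ (antipode_bilinear antipode)) mulr1.
Qed.

Definition haar_antipode_mul a b : R[i] := haar (a * antipode b).

Lemma haar_antipode_mul_linear a : scalar (haar_antipode_mul a).
Proof.
by move=> k b c; rewrite /haar_antipode_mul linearP mulrDr -scalerAr linearP.
Qed.

HB.instance Definition _ a :=
  GRing.isLinear.Build R[i] A R[i] _ (haar_antipode_mul a)
    (haar_antipode_mul_linear a).

Lemma cond_exp_bilinear :
  is_bilinear (fun a (b : cop A) => slice (haar_antipode_mul a) (comul (b : A))).
Proof.
split=> [b k a a'|a k b b'] /=; last by rewrite !linearP.
move: (comul _); apply: tensor_linear_ext => [l X Y|l X Y|c d].
- by rewrite linearP.
- rewrite [slice (_ a) _]linearP [slice (_ a') _]linearP.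
  by rewrite !scalerDr !scalerA [l * k]mulrC addrACA.
by rewrite !sliceE /= /haar_antipode_mul mulrDl -scalerAl linearP scalerDl scalerA.
Qed.

(* The adjoint of the coproduct for the Haar states:
   a ⊗ b |-> h(a S(b_(1))) b_(2). *)
Definition cond_exp : T -> A :=
  tlift (fun a (b : cop A) => slice (haar_antipode_mul a) (comul (b : A))).

HB.instance Definition _ :=
  GRing.isLinear.Build R[i] T A _ cond_exp (tlift_linear cond_exp_bilinear).

Lemma cond_expE a b :
  cond_exp (a ⊗ to_cop b) = slice (haar_antipode_mul a) (comul b).
Proof. exact: tliftE cond_exp_bilinear. Qed.

(** On u_ij the coefficient of u_lj is h of the sum over k of u_ik star(u_lk), which unitarity turns
    into a Kronecker delta. *)
Lemma cond_exp_comul_tilde c : cond_exp (D c) = c.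
Proof.
move: c; apply: coef_linear_ext => [k a b|k a b|n u i j hu]; rewrite ?linearP //.
rewrite comul_tildeE; have [-> _ _] := hu; rewrite raddf_sum /=.
transitivity (\sum_k \sum_l haar (u i k * star (u l k)) *: u l j).
  apply: eq_bigr => k _; rewrite [LHS]cond_expE.
  rewrite [LHS](tlift_comul_coef _ _
    (@slice_bilinear _ A A (haar_antipode_mul (u i k))) hu).
  by apply: eq_bigr => l _; rewrite /= /haar_antipode_mul antipode_coef.
rewrite exchange_big /= (bigD1 i) //= [X in _ + X]big1 => [|l /negPf li].
  rewrite -scaler_suml -raddf_sum corep_mulstar // eqxx mulr1n.
  by rewrite /= haar1 scale1r addr0.
by rewrite -scaler_suml -raddf_sum corep_mulstar // eq_sym li mulr0n raddf0 scale0r.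
Qed.

Lemma haar_cond_exp x : haar (cond_exp x) = haar2 x.
Proof.
move: x; apply: (@tensor_linear_ext _ _ _ R[i]^o) => [k x y|k x y|a b].
- by rewrite !linearP.
- by rewrite linearP.
rewrite [cond_exp _]cond_expE [RHS]tensor_functionalE.
(* Applying h to the second leg first lets right invariance replace b_(1) h(b_(2)) by h(b) 1. *)
have swap (X : A ⊙ A) : haar (slice (haar_antipode_mul a) X) =
    haar_antipode_mul a (tlift (fun c d => haar d *: c) X).
  have bh := counit_bilinear' (@haar R A).
  move: X; apply: (@tensor_linear_ext _ _ _ R[i]^o) => [k x y|k x y|c d].
  - by rewrite !linearP.
  - by rewrite (tlift_linear bh) linearP.
  by rewrite sliceE (tliftE _ _ bh) !linearZ /= mulrC.
rewrite swap haar_invr linearZ /= /haar_antipode_mul antipode1 mulr1 mulrC.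
by [].
Qed.

Hypothesis kac : kac_type A.

(** Apply right invariance to star(u_pj) u_ij and sum over j. Traciality turns the sums over j of
    h(star(u_lj) u_qj) into Kronecker deltas, by unitarity of u. *)
Lemma kac_corep_starmul n (u : 'M[A]_n) p i : unitary_corep u ->
  \sum_l star (u p l) * u i l = (p == i)%:R.
Proof.
move=> hu; have bh := counit_bilinear' (@haar R A).
have inv j : \sum_l \sum_q haar (star (u l j) * u q j) *: (star (u p l) * u i q) =
    (haar (star (u p j) * u i j))%:A.
  rewrite -haar_invr comulM comul_star; have [uD _ _] := hu; rewrite !uD.
  rewrite star_sum mulr_suml tlift_sum //; apply: eq_bigr => l _.
  rewrite mulr_sumr tlift_sum //; apply: eq_bigr => q _.
  by rewrite star_tensor pureM tliftE.
have orth l q : \sum_j haar (star (u l j) * u q j) = (q == l)%:R.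
  under eq_bigr => j _ do rewrite kac.
  rewrite -raddf_sum corep_mulstar //=; case: eqP => _; first exact: haar1.
  exact: raddf0.
transitivity (\sum_j (haar (star (u p j) * u i j))%:A : A); last first.
  by rewrite -scaler_suml orth eq_sym scaler_nat.
under [RHS]eq_bigr => j _ do rewrite -inv.
rewrite exchange_big /=; apply: eq_bigr => l _; rewrite exchange_big /=.
rewrite (bigD1 l) //= [X in _ + X]big1 => [|q /negPf ql].
  by rewrite -scaler_suml orth eqxx scale1r addr0.
by rewrite -scaler_suml orth ql scale0r.
Qed.

(** For the entrywise star of u, applying S gives a left inverse, and [kac_corep_starmul] says that
    the transpose of u is a right inverse. *)
Lemma kac_antipode_star a : antipode (star a) = star (antipode a).
Proof.
move: a; apply: sesqui_coef_ext => [k a b|k a b|n u i j hu].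
- by rewrite starD starZ linearP.
- by rewrite linearP starD starZ.
rewrite antipode_coef // starK.
have uE q : \sum_k antipode (star (u i k)) * star (u k q) = (i == q)%:R.
  have := antipodel (star (u i q)); rewrite counit_star counit_coef // rmorph_nat.
  rewrite scaler_nat comul_star => <-; have [-> _ _] := hu.
  rewrite star_sum tlift_sum; last exact: antipode_bilinear.
  apply: eq_bigr => k _; rewrite star_tensor tliftE //.
  exact: antipode_bilinear.
transitivity (\sum_k antipode (star (u i k)) * (\sum_l star (u k l) * u j l)).
  under eq_bigr => k _ do rewrite kac_corep_starmul //.
  rewrite (bigD1 j) //= eqxx mulr1 big1 ?addr0 // => k /negPf ->.
  by rewrite mulr0.
under eq_bigr => k _ do rewrite mulr_sumr.
rewrite exchange_big /=.
under eq_bigr => l _.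
  under eq_bigr => k _ do rewrite mulrA.
  rewrite -mulr_suml uE; over.
exact: sum_delta_mul.
Qed.

Definition mul_antipode a b : A := a * antipode b.

Lemma mul_antipode_linear a : linear (mul_antipode a).
Proof. by move=> k b c; rewrite /mul_antipode linearP mulrDr -scalerAr. Qed.

HB.instance Definition _ a :=
  GRing.isLinear.Build R[i] A A _ (mul_antipode a) (mul_antipode_linear a).

Lemma twist_bilinear :
  is_bilinear (fun a (b : cop A) => tmap (mul_antipode a) idfun (comul (b : A))).
Proof.
split=> [b k a a'|a k b b'] /=; last by rewrite !linearP.
move: (comul _); apply: tensor_linear_ext => [l X Y|l X Y|c d].
- by rewrite linearP.
- rewrite [tmap (_ a) _ _]linearP [tmap (_ a') _ _]linearP.
  by rewrite !scalerDr !scalerA [l * k]mulrC addrACA.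
by rewrite !tmapE /= /mul_antipode mulrDl -scalerAl pureDl pureZl.
Qed.

(** The map W: a ⊗ b goes to a S(b_(1)) ⊗ b_(2), so that slicing it by h gives [cond_exp]. *)
Definition twist : T -> A ⊙ A :=
  tlift (fun a (b : cop A) => tmap (mul_antipode a) idfun (comul (b : A))).

HB.instance Definition _ :=
  GRing.isLinear.Build R[i] T (A ⊙ A) _ twist (tlift_linear twist_bilinear).

Lemma twistE a b :
  twist (a ⊗ to_cop b) = tmap (mul_antipode a) idfun (comul b).
Proof. exact: tliftE twist_bilinear. Qed.

(** On elementary tensors, S(star c c') = S(c') star(S(c)), and the trace moves the last factor to
    the front, where it completes star(a S(c)). *)
Lemma cond_exp_starmul x y :
  cond_exp (star x * y) = slice haar (star (twist x) * twist y).
Proof.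
move: x; apply: (@tensor_linear_ext _ _ _ (conj_mod A)) => [k x z|k x z|a b].
- by rewrite starD starZ mulrDl -scalerAl linearP.
- by rewrite linearP starD starZ mulrDl -scalerAl linearP.
move: y; apply: (@tensor_linear_ext _ _ _ A) => [k x z|k x z|a' b'].
- by rewrite mulrDr -scalerAr linearP.
- by rewrite linearP mulrDr -scalerAr linearP.
rewrite star_tensor pureM [LHS]cond_expE !twistE comulM comul_star.
move: (comul (b : A)) (comul (b' : A)) => X Y; move: X.
apply: (@tensor_linear_ext _ _ _ (conj_mod A)) => [k x z|k x z|c d].
- by rewrite starD starZ mulrDl -scalerAl linearP.
- by rewrite linearP starD starZ mulrDl -scalerAl linearP.
move: Y; apply: (@tensor_linear_ext _ _ _ A) => [k x z|k x z|c' d'].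
- by rewrite mulrDr -scalerAr linearP.
- by rewrite linearP mulrDr -scalerAr linearP.
rewrite !tmapE !star_tensor !pureM !sliceE /= /haar_antipode_mul.
rewrite antipodeM kac_antipode_star /mul_antipode starM mulrA kac.
by rewrite !mulrA.
Qed.

Lemma cond_exp_sos x : sos x -> sos (cond_exp x).
Proof.
move=> [s [_ ->]]; rewrite raddf_sum; apply: sos_sum => c _.
by rewrite /= cond_exp_starmul; apply: slice_haar_sos.
Qed.

Lemma kac_expected : expected (@tensor_haar R A (cop A)) (range D).
Proof.
exists (GRing.Linear.clone _ _ _ _ (D \o cond_exp) _); split.
- split=> [x|]; first by rewrite /= cond_exp_comul_tilde.
  apply/seteqP; split=> _ [x _ <-] /=; first by exists (cond_exp x).
  by exists (D x) => //=; rewrite cond_exp_comul_tilde.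
- by rewrite /= -(comul_tilde1 A) cond_exp_comul_tilde.
(* [D] is a *-homomorphism, so it carries squares in A to squares of elements of its range. *)
- move=> x /cond_exp_sos[s [_ sE]]; exists [seq D b | b <- s]; split.
    by move=> _ /mapP[b _ ->]; exists b.
  rewrite /= sE raddf_sum big_map; apply: eq_bigr => b _.
  by rewrite /= comul_tildeM comul_tilde_star.
by move=> x; rewrite !tensor_haarE /= haar2_comul_tilde haar_cond_exp.
Qed.

End KacExpected.

Theorem proposition3p5 (R : realType) (A : cqgType R) :
  expected (@tensor_haar R A (cop A)) (range (@comul_tilde R A)) <->
  kac_type A.
Proof.
split; last exact: kac_expected.
move=> [E [[EE rE] E1 E_pos haar2E]].
apply: (expected_kac EE rE E1 E_pos) => x; rewrite -!tensor_haarE.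
exact: haar2E.
Qed.
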